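(* Let $\mathfrak R$ be the Sierpiński gasket or the pentagonal Sierpiński carpet iterated graph system, with replacement graphs $G_m$ and with the flipping symmetries $\eta_t$ ($t\in\mathcal T$) described in the context. Let $p\in(1,\infty)$ and $q=\frac{p}{p-1}$. Then there is a constant $C_{\mathrm{FB}}>0$, independent of $m\in\mathbb N$ and of $t\in\mathcal T$, such that for every $m\in\mathbb N$ there exists a flow basis $\mathcal F^{(m)}$ of $\widetilde G_m$ with \[ \mathcal E_q(\mathcal F^{(m)})\le C_{\mathrm{FB}}\cdot\mathcal E_q\!\left(I_{t,-}^{(m)},I_{t,+}^{(m)},G_m\right)\quad\text{for all }t\in\mathcal T. \]
   Context: Graphs: $(V,E)$, $V$ finite non-empty, $E\subseteq V\times V$, $(x,y)\in E\Rightarrow(y,x)\notin E$; $\{x,y\}\in E$ means either orientation. Flows: an antisymmetric $F:V\times V\to\mathbb R$ ($F(x,y)=-F(y,x)$, $F(x,y)=0$ unless $\{x,y\}\in E$) is a flow from $A$ to $B$ (disjoint non-empty) if $\operatorname{div}F(x):=\sum_{\{x,y\}\in E}F(x,y)=0$ for $x\notin A\cup B$; unit if $\sum_{x\in A}\operatorname{div}F(x)=1$; $\mathcal E_q(F)=\sum_{\{x,y\}\in E}|F(x,y)|^q$ (each edge once); $\mathcal E_q(A,B,G)=\inf\{\mathcal E_q(F):F$ unit flow from $A$ to $B$ in $G\}$. An iterated graph system: connected graph $G_1=(S,E)$, types $\mathcal T$, surjective typing $\mathfrak t$, gluing rules $I_t\subseteq S\times S$; $I_{t,+}$, $I_{t,-}$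 are the sets of first, resp. second, coordinates of $I_t$ and $I^{(m)}_{t,\star}=(I_{t,\star})^m$. With $W_m=S^m$, $[w]_k=w_1\cdots w_k$, replacement graphs $G_m=(W_m,E_m)$: $(w,v)\in E_{m+1}$ iff (1) $[w]_m=[v]_m$ and $(w_{m+1},v_{m+1})\in E$ (type $\mathfrak t(w_{m+1},v_{m+1})$) or (2) $([w]_m,[v]_m)\in E_m$ and $(w_{m+1},v_{m+1})\in I_{\mathfrak t([w]_m,[v]_m)}$ (type $\mathfrak t([w]_m,[v]_m)$). Sierpiński gasket: $S=\{0,1,2\}$, $E=\{(0,1),(1,2),(0,2)\}$ of types $a,b,c$, $I_a=\{(1,0)\}$, $I_b=\{(2,1)\}$, $I_c=\{(2,0)\}$; flipping symmetries: $\eta_a$ fixes $2$ and swaps $0,1$; $\eta_b$ fixes $0$ and swaps $1,2$; $\eta_c$ fixes $1$ and swaps $0,2$. Pentagonal Sierpiński carpet: $S=\{0,\dots,4\}$ (arithmetic mod 5), $E=\{(0,1),(1,2),(2,3),(3,4),(4,0)\}$ of types $a,b,c,d,e$, $I_a=\{(1,0),(2,4)\}$, $I_b=\{(2,1),(3,0)\}$, $I_c=\{(3,2),(4,1)\}$, $I_d=\{(4,3),(0,2)\}$, $I_e=\{(0,4),(1,3)\}$; for $k\in S$ let $\eta^{(k)}$ be the involution of $S$ fixing $k$ with $\eta^{(k)}(k+1)=k-1$ and $\eta^{(k)}(k+2)=k+3$; the flipping symmetry of the type of the edge $(i,i+1)$ is $\eta^{(i+3)}$. Flipping symmetries act on $W_m$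 letterwise. Flow basis: $\mathcal L^{(m)}=\{I^{(m)}_{t,\star}:t\in\mathcal T,\star\in\{+,-\}\}$ (a set; equal sets identified). $\widetilde G_m$ has vertex set $W_m\cup\{v_L:L\in\mathcal L^{(m)},v\in L\}$ (new formal symbols) and edges $E_m\cup\{\{v_L,v\}:L\in\mathcal L^{(m)},v\in L\}$; $\widetilde L=\{v_L:v\in L\}$. A flow basis is a collection $\mathcal F^{(m)}$ of flows in $\widetilde G_m$ with: (FB1) each member is a unit flow from $\widetilde L_1$ to $\widetilde L_2$ for distinct $L_1,L_2\in\mathcal L^{(m)}$, with exactly one member, $\mathcal F_{[L_1\to L_2]}$, for each ordered pair of distinct $L_1,L_2$; (FB2) if $L\notin\{L_1,L_2\}$ then $\mathcal F_{[L_1\to L_2]}(v_L,v)=0$ for $v\in L$; (FB3) if $L\notin\{L_1,L_2\}$ then for $v\in L$, $\mathcal F_{[L\to L_1]}(v_L,v)=\mathcal F_{[L\to L_2]}(v_L,v)$ and $\mathcal F_{[L_1\to L]}(v,v_L)=\mathcal F_{[L_2\to L]}(v,v_L)$; (FB4) if $L_1=I^{(m)}_{t,\star}$, $L_2=I^{(m)}_{t,-\star}$ then for $v\in L_1$, $\mathcal F_{[L_1\to L_2]}(v_{L_1},v)=\mathcal F_{[L_1\to L_2]}(\eta_t(v),\eta_t(v)_{L_2})$ and $\mathcal F_{[L_1\to L_2]}(v_{L_1},v)=\mathcal F_{[L_2\to L_1]}(v,v_{L_1})$. $\mathcal E_q(\mathcal F^{(m)})=\max_{F\in\mathcal F^{(m)}}\mathcal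 E_q(F)$. *)

(* Defs.v *)
From HB Require Import structures.
From mathcomp Require Import all_boot all_order all_algebra.
From mathcomp Require Import all_classical all_reals all_analysis.
Set Implicit Arguments. Unset Strict Implicit. Unset Printing Implicit Defensive.
Import Order.TTheory GRing.Theory Num.Theory.
Local Open Scope ring_scope.

Section Flows.
Variables (R : realType) (V : finType) (E : rel V).

Definition uedge (x y : V) : bool := E x y || E y x.

Definition flow_fn (F : V -> V -> R) : Prop :=
  (forall x y, F x y = - F y x) /\ (forall x y, ~~ uedge x y -> F x y = 0).

Definition divF (F : V -> V -> R) (x : V) : R :=
  \sum_(y | uedge x y) F x y.

Definition is_flow (A B : {set V}) (F : V -> V -> R) : Prop :=
  [/\ [disjoint A & B], A != finset.set0, B != finset.set0, flow_fn F &
      forall x, x \notin A -> x \notin B -> divF F x = 0].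

Definition is_unit_flow (A B : {set V}) (F : V -> V -> R) : Prop :=
  is_flow A B F /\ \sum_(x in A) divF F x = 1.

(* q-energy: each (oriented) edge counted once *)
Definition energy (q : R) (F : V -> V -> R) : R :=
  \sum_(x : V) \sum_(y : V | E x y) (`|F x y| `^ q).

Definition Eq_res (q : R) (A B : {set V}) : R :=
  inf [set e | exists F, is_unit_flow A B F /\ e = energy q F].

End Flows.

Record IGS := {
  S_ : finType;               (* letters / vertices of G_1 *)
  T_ : finType;
  E0 : rel S_;                (* oriented edges of G_1 *)
  typ : S_ -> S_ -> T_;       (* typing of edges of G_1 *)
  Irule : T_ -> rel S_;       (* gluing rules I_t *)
  eta : T_ -> S_ -> S_
}.

Section Replacement.
Variable sys : IGS.
Local Notation S := (S_ sys).
Local Notation T := (T_ sys).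

(* Edge type between two words given REVERSED (last letter first);
   None if they are not joined by an edge. Clause (1) / clause (2)
   of the definition of E_{m+1}. *)
Fixpoint etype_rev (w v : seq S) : option T :=
  match w, v with
  | a :: w', b :: v' =>
      if w' == v' then (if E0 a b then Some (typ a b) else None)
      else match etype_rev w' v' with
           | Some t => if Irule t a b then Some t else None
           | None => None
           end
  | _, _ => None
  end.

Definition Em (m : nat) : rel (m.-tuple S) :=
  fun w v => etype_rev (rev w) (rev v) != None.

(* I_{t,+} (b = true) and I_{t,-} (b = false) *)
Definition Iside (t : T) (b : bool) : {set S} :=
  if b then [set x | [exists y, Irule t x y]]
  else [set y | [exists x, Irule t x y]].

Definition Iwm (m : nat) (t : T) (b : bool) : {set m.-tuple S} :=
  [set w : m.-tuple S | all (fun a => a \in Iside t b) w].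

Definition Lm (m : nat) : {set {set m.-tuple S}} :=
  [set Iwm m t b | t : T, b : bool].

(* formal symbols v_L *)
Definition tsym (m : nat) :=
  {x : {set m.-tuple S} * m.-tuple S | (x.1 \in Lm m) && (x.2 \in x.1)}.

Definition tV (m : nat) : finType := (m.-tuple S + tsym m)%type.

(* edges of \tilde G_m : E_m, plus {v_L, v} (oriented v_L -> v) *)
Definition tE (m : nat) : rel (tV m) :=
  fun x y => match x, y with
             | inl w, inl v => Em w v
             | inr s, inl v => (val s).2 == v
             | _, _ => false
             end.

Definition tildeL (m : nat) (L : {set m.-tuple S}) : {set tV m} :=
  [set x : tV m | if x is inr s then (val s).1 == L else false].

Definition eta_m (m : nat) (t : T) (w : m.-tuple S) : m.-tuple S :=
  map_tuple (eta t) w.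

(* A flow basis, given as the family (L1, L2) |-> F_[L1 -> L2]. *)
Definition is_flow_basis (R : realType) (m : nat)
    (FB : {set m.-tuple S} -> {set m.-tuple S} -> tV m -> tV m -> R) : Prop :=
  (forall L1 L2, L1 \in Lm m -> L2 \in Lm m -> L1 != L2 ->
     is_unit_flow (@tE m) (tildeL L1) (tildeL L2) (FB L1 L2)) /\
  (forall L1 L2 (s : tsym m), L1 \in Lm m -> L2 \in Lm m -> L1 != L2 ->
     (val s).1 != L1 -> (val s).1 != L2 ->
     FB L1 L2 (inr s) (inl (val s).2) = 0) /\
  (forall L1 L2 (s : tsym m), L1 \in Lm m -> L2 \in Lm m ->
     (val s).1 != L1 -> (val s).1 != L2 ->
     FB (val s).1 L1 (inr s) (inl (val s).2)
       = FB (val s).1 L2 (inr s) (inl (val s).2) /\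
     FB L1 (val s).1 (inl (val s).2) (inr s)
       = FB L2 (val s).1 (inl (val s).2) (inr s)) /\
  (forall (t : T) (b : bool) (s1 s2 : tsym m),
     (val s1).1 = Iwm m t b -> (val s2).1 = Iwm m t (~~ b) ->
     (val s2).2 = eta_m t (val s1).2 ->
     FB (Iwm m t b) (Iwm m t (~~ b)) (inr s1) (inl (val s1).2)
       = FB (Iwm m t b) (Iwm m t (~~ b)) (inl (val s2).2) (inr s2) /\
     FB (Iwm m t b) (Iwm m t (~~ b)) (inr s1) (inl (val s1).2)
       = FB (Iwm m t (~~ b)) (Iwm m t b) (inl (val s1).2) (inr s1)).

Definition FB_energy (R : realType) (m : nat) (q : R)
    (FB : {set m.-tuple S} -> {set m.-tuple S} -> tV m -> tV m -> R) : R :=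
  \big[Num.max/0]_(L1 in Lm m)
    \big[Num.max/0]_(L2 in Lm m | L1 != L2) energy (@tE m) q (FB L1 L2).

End Replacement.

(* Sierpinski gasket: S = {0,1,2}, types a,b,c = 0,1,2 *)
Definition sg_E (x y : 'I_3) : bool :=
  [|| (val x == 0%N) && (val y == 1%N),
      (val x == 1%N) && (val y == 2%N) |
      (val x == 0%N) && (val y == 2%N)].

Definition sg_typ (x y : 'I_3) : 'I_3 :=
  if (val x == 0%N) && (val y == 1%N) then inord 0
  else if (val x == 1%N) && (val y == 2%N) then inord 1
  else inord 2.

Definition sg_I (t : 'I_3) (x y : 'I_3) : bool :=
  match val t with
  | 0%N => (val x == 1%N) && (val y == 0%N)
  | 1%N => (val x == 2%N) && (val y == 1%N)
  | _ => (val x == 2%N) && (val y == 0%N)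
  end.

Definition swap3 (i j : nat) (x : 'I_3) : 'I_3 :=
  if val x == i then inord j else if val x == j then inord i else x.

Definition sg_eta (t : 'I_3) : 'I_3 -> 'I_3 :=
  match val t with
  | 0%N => swap3 0 1
  | 1%N => swap3 1 2
  | _ => swap3 0 2
  end.

Definition gasket : IGS :=
  {| S_ := 'I_3; T_ := 'I_3; E0 := sg_E; typ := sg_typ;
     Irule := sg_I; eta := sg_eta |}.

(* Pentagonal Sierpinski carpet: S = {0,...,4} mod 5, type of (i,i+1) is i *)
Definition m5 (n : nat) : 'I_5 := inord (n %% 5).

Definition pc_E (x y : 'I_5) : bool := y == m5 (val x + 1).

Definition pc_typ (x y : 'I_5) : 'I_5 := x.

Definition pc_I (t : 'I_5) (x y : 'I_5) : bool :=
  ((x == m5 (val t + 1)) && (y == t)) ||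
  ((x == m5 (val t + 2)) && (y == m5 (val t + 4))).

Definition eta5 (k : 'I_5) (x : 'I_5) : 'I_5 :=
  if x == k then k
  else if x == m5 (val k + 1) then m5 (val k + 4)
  else if x == m5 (val k + 4) then m5 (val k + 1)
  else if x == m5 (val k + 2) then m5 (val k + 3)
  else m5 (val k + 2).

Definition pc_eta (t : 'I_5) : 'I_5 -> 'I_5 := eta5 (m5 (val t + 3)).

Definition pentagon : IGS :=
  {| S_ := 'I_5; T_ := 'I_5; E0 := pc_E; typ := pc_typ;
     Irule := pc_I; eta := pc_eta |}.

(* Main.v *)
(** Write A for the side I_{t,-} of a type t and B for I_{t,+}.  Antisymmetrising
    a nearly optimal unit flow from A to B under the flipping symmetry gives a
    flow whose sink profile on B is the mirror image of its source profile g on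
    A.  Pushing a flow forward along a graph map with fibres of size at most two
    multiplies the energy by a bounded factor.  For the pentagonal carpet, fold
    the graph along the mirror exchanging B with the side next to A: the result
    is a flow from g to its rotation by one step.  (For the gasket, where sides
    are corners, no folding is needed.)  Averaging g with its image under the
    reflection tau preserving A gives a symmetric profile f; the rotations of f
    are compatible with all the flipping symmetries, and concatenating the
    rotated flows joins any two of them.  Since the degrees of the G_m are
    bounded, the q-norm of f, which is the energy on the added edges, is also
    controlled by the energy of the original flow. *)

Require Import Defs.
From HB Require Import structures.
From mathcomp Require Import all_boot all_order all_algebra.
From mathcomp Require Import all_classical all_reals all_analysis.
From mathcomp Require Import lra.
Import Order.TTheory GRing.Theory Num.Theory.
Local Open Scope ring_scope.
Set Implicit Arguments. Unset Strict Implicit. Unset Printing Implicit Defensive.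

(** * Transport along graphs *)

Section PowerSums.
Variables (R : realType) (q : R).
Hypothesis q1 : 1 <= q.

Let q0 : 0 < q. Proof. exact: lt_le_trans q1. Qed.

(** Each term is at most the [1/q]-th power of the sum [s] on the right, so at most [N] terms add up
    to at most [N] times that power. *)
Lemma powR_sum_le (I : finType) (P : pred I) (a : I -> R) (N : nat) :
  (#|P| <= N)%N ->
  `|\sum_(i | P i) a i| `^ q <= N%:R `^ q * \sum_(i | P i) `|a i| `^ q.
Proof.
move=> PN; set s := \sum_(i | P i) `|a i| `^ q.
have s0 : 0 <= s by apply: sumr_ge0 => i _; exact: powR_ge0.
have sq : (s `^ q^-1) `^ q = s by rewrite -powRrM mulVf ?gt_eqF // powRr1.
have le_a i : P i -> `|a i| <= s `^ q^-1.
  move=> Pi; have -> : `|a i| = (`|a i| `^ q) `^ q^-1.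
    by rewrite -powRrM mulfV ?gt_eqF // powRr1.
  apply: ge0_ler_powR; rewrite ?nnegrE ?powR_ge0 ?invr_ge0 ?(ltW q0) //.
  rewrite /s (bigD1 i) //= lerDl; apply: sumr_ge0 => j _; exact: powR_ge0.
rewrite -{1}sq -powRM ?powR_ge0 ?ler0n //.
apply: ge0_ler_powR; rewrite ?nnegrE ?mulr_ge0 ?powR_ge0 ?(ltW q0) //.
apply: le_trans (ler_norm_sum _ _ _) _.
apply: le_trans (ler_sum _ le_a) _.
rewrite sumr_const -[leLHS]mulr_natl; apply: ler_wpM2r; first exact: powR_ge0.
by rewrite ler_nat.
Qed.

(** Summing over ordered pairs, without reference to edges, suits comparison under graph maps; for
    flows the result agrees with [energy] up to a factor 2. *)
Definition cost (V : finType) (F : V -> V -> R) : R :=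
  \sum_x \sum_y `|F x y| `^ q.

Lemma cost_ge0 (V : finType) (F : V -> V -> R) : 0 <= cost F.
Proof. by apply: sumr_ge0 => x _; apply: sumr_ge0 => y _; exact: powR_ge0. Qed.

Section OneGraph.
Variables (V : finType) (E : rel V).
Implicit Types (F : V -> V -> R) (d : V -> R).

Lemma divFE F x : flow_fn E F -> divF E F x = \sum_y F x y.
Proof.
case=> _ F0; rewrite /divF [RHS](bigID (uedge E x)) /=.
by rewrite [X in _ + X]big1 ?addr0 // => y /F0.
Qed.

Lemma sum_divF F : flow_fn E F -> \sum_x divF E F x = 0.
Proof.
move=> fF; have anti : \sum_x \sum_y F x y = - \sum_x \sum_y F x y.
  rewrite {1}exchange_big /= -sumrN; apply: eq_bigr => x _.
  by rewrite -sumrN; apply: eq_bigr => y _; case: fF => ->.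
under eq_bigr do rewrite divFE //.
lra.
Qed.

Lemma energy_le_cost F : energy E q F <= cost F.
Proof.
apply: ler_sum => x _; rewrite [leRHS](bigID (E x)) /= lerDl.
by apply: sumr_ge0 => y _; exact: powR_ge0.
Qed.

Lemma cost_le_energy F : flow_fn E F -> cost F <= 2 * energy E q F.
Proof.
move=> [aF F0].
have -> : 2 * energy E q F = energy E q F +
    \sum_x \sum_(y | E y x) `|F x y| `^ q.
  rewrite mulr2n mulrDl mul1r; congr (_ + _).
  rewrite /energy.
  under eq_bigr do rewrite big_mkcond /=.
  under [RHS]eq_bigr do rewrite big_mkcond /=.
  rewrite exchange_big /=; apply: eq_bigr => x _; apply: eq_bigr => y _.
  by rewrite aF normrN.
rewrite -big_split /=; apply: ler_sum => x _.
rewrite [\sum_(y | E x y) _]big_mkcond [\sum_(y | E y x) _]big_mkcond.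
rewrite -big_split /=; apply: ler_sum => y _.
have := F0 x y; rewrite /uedge; have := powR_ge0 `|F x y| q.
case: (E x y); case: (E y x) => /= h0 h; rewrite ?addr0 ?add0r ?lerDl //.
by rewrite h // normr0 powR0 ?gt_eqF.
Qed.

(** The divergence is prescribed at every vertex, which makes the notion linear in [d]: flows
    between profiles can be added and scaled. *)
Definition transport (c : R) d :=
  exists F, [/\ flow_fn E F, forall x, divF E F x = d x & cost F <= c].

Lemma transport_ext c d d' : d =1 d' -> transport c d -> transport c d'.
Proof. by move=> dd [F [? Fd ?]]; exists F; split=> // x; rewrite Fd dd. Qed.

Lemma transport_le c c' d : c <= c' -> transport c d -> transport c' d.
Proof. by move=> cc [F [? ? Fc]]; exists F; split=> //; exact: le_trans cc. Qed.

Lemma transport_scale c (a : R) d :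
  `|a| <= 1 -> transport c d -> transport c (fun x => a * d x).
Proof.
move=> a1 [F [[aF F0] Fd Fc]]; exists (fun x y => a * F x y); split.
- by split=> x y; [rewrite aF mulrN | move=> /F0 ->; rewrite mulr0].
- by move=> x; rewrite -Fd /divF mulr_sumr.
- apply: le_trans Fc; apply: ler_sum => x _; apply: ler_sum => y _.
  rewrite normrM powRM // ler_piMl ?powR_ge0 //.
  have -> : (1 : R) = 1 `^ q by rewrite powR1.
  by apply: ge0_ler_powR; rewrite ?nnegrE ?(ltW q0).
Qed.

(** One factor for both operations on flows: a sum costs [2 * 2 ^ q], and a push-forward with fibres
    of size at most two costs [4 ^ q]. *)
Definition dilation : R := 2 * 4 `^ q.

Lemma powR_dilation (n : nat) : (n <= 4)%N -> 2 * n%:R `^ q <= dilation.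
Proof.
move=> n4; rewrite ler_pM2l //; apply: ge0_ler_powR; rewrite ?nnegrE //.
- exact: ltW.
- by rewrite ler_nat.
Qed.

Lemma dilation_ge1 : 1 <= dilation.
Proof.
have := @powR_dilation 1 isT; rewrite powR1; lra.
Qed.

Lemma transport_add c d d' : transport c d -> transport c d' ->
  transport (dilation * c) (fun x => d x + d' x).
Proof.
move=> [F [[aF F0] Fd Fc]] [F' [[aF' F0'] Fd' Fc']].
exists (fun x y => F x y + F' x y); split.
- split=> x y; first by rewrite aF aF' opprD.
  by move=> xy; rewrite F0 ?F0' ?addr0.
- by move=> x; rewrite -Fd -Fd' /divF big_split.
- have c0 : 0 <= c := le_trans (cost_ge0 F) Fc.
  have le2 (a b : R) : `|a + b| `^ q <= 2 `^ q * (`|a| `^ q + `|b| `^ q).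
    have := @powR_sum_le bool predT (fun i => if i then a else b) 2.
    by rewrite card_bool !big_bool /=; apply.
  apply: (@le_trans _ _ (2 `^ q * (cost F + cost F'))).
    rewrite /cost -big_split /= mulr_sumr; apply: ler_sum => x _.
    rewrite -big_split /= mulr_sumr; apply: ler_sum => y _; exact: le2.
  apply: (@le_trans _ _ (2 * 2 `^ q * c)).
    rewrite mulrC -mulrA [2 `^ q * c]mulrC mulrA ler_wpM2r ?powR_ge0 //; lra.
  by apply: (ler_wpM2r c0); exact: (@powR_dilation 2 isT).
Qed.

End OneGraph.

(** * Pushing flows forward along graph maps *)

Section PushForward.
Variable V : finType.
Implicit Types (d : V -> R) (phi psi : V -> V).

Definition push phi d x : R := \sum_(y | phi y == x) d y.

Lemma eq_push phi d d' : d =1 d' -> push phi d =1 push phi d'.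
Proof. by move=> dd x; apply: eq_bigr. Qed.

Lemma pushD phi d d' x :
  push phi (fun y => d y + d' y) x = push phi d x + push phi d' x.
Proof. exact: big_split. Qed.

Lemma pushB phi d d' x :
  push phi (fun y => d y - d' y) x = push phi d x - push phi d' x.
Proof. exact: sumrB. Qed.

Lemma pushZ phi (a : R) d x : push phi (fun y => a * d y) x = a * push phi d x.
Proof. by rewrite /push mulr_sumr. Qed.

Lemma push_comp phi psi d : push phi (push psi d) =1 push (phi \o psi) d.
Proof.
move=> x; rewrite /push (exchange_big_dep (fun y => phi (psi y) == x)) /=.
  apply: eq_bigr => y /eqP yx; rewrite (big_pred1 (psi y)) // => z /=.
  rewrite [psi y == z]eq_sym.
  by case: (eqVneq z (psi y)) => [->|]; rewrite ?yx ?eqxx ?andbF.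
by move=> z y /eqP <- /eqP ->.
Qed.

Lemma eq_push_supp phi psi d :
  (forall x, d x != 0 -> phi x = psi x) -> push phi d =1 push psi d.
Proof.
move=> h x; rewrite /push big_mkcond [RHS]big_mkcond; apply: eq_bigr => y _.
case: (eqVneq (d y) 0) => [->|/h ->] //; by rewrite !if_same.
Qed.

Lemma push_id d : push id d =1 d.
Proof. by move=> x; rewrite /push big_pred1_eq. Qed.

Lemma push_inj phi d x : injective phi -> push phi d (phi x) = d x.
Proof. by move=> i; rewrite /push (big_pred1 x) // => y /=; rewrite inj_eq. Qed.

Lemma push_supp phi d (A B : {set V}) : (forall x, x \notin A -> d x = 0) ->
  (forall x, x \in A -> phi x \in B) -> forall x, x \notin B -> push phi d x = 0.
Proof.
move=> dA AB x xB; apply: big1 => y /eqP yx; apply: dA.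
by apply: contra xB => /AB; rewrite yx.
Qed.

Lemma sum_push phi (G : R -> R) d : injective phi ->
  \sum_x G (push phi d x) = \sum_x G (d x).
Proof.
move=> i; rewrite (reindex_inj i); apply: eq_bigr => x _; by rewrite push_inj.
Qed.

(** Add up the flow over pairs of fibres. Edges collapsed by [phi] cancel by antisymmetry, and two
    fibres span at most four pairs of points, so the power sum inequality loses [4 ^ q]. *)
Lemma transport_push (E : rel V) c phi d :
  (forall x y, uedge E x y -> uedge E (phi x) (phi y) \/ phi x = phi y) ->
  (forall x, (#|[pred y | phi y == x]| <= 2)%N) ->
  transport E c d -> transport E (dilation * c) (push phi d).
Proof.
move=> hom fib [F [fF Fd Fc]]; have [aF F0] := fF.
pose G x y := \sum_(x' | phi x' == x) \sum_(y' | phi y' == y) F x' y'.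
have aG x y : G x y = - G y x.
  rewrite /G exchange_big /= -sumrN; apply: eq_bigr => y' _.
  by rewrite -sumrN; apply: eq_bigr => x' _; rewrite aF.
have fG : flow_fn E G.
  split=> // x y xy; case: (eqVneq x y) => [<-|nxy].
    have := aG x x; lra.
  apply: big1 => x' /eqP x'x; apply: big1 => y' /eqP y'y; apply: F0.
  apply/negP => /hom; rewrite x'x y'y => -[e|e].
    by rewrite e in xy.
  by rewrite e eqxx in nxy.
exists G; split=> //.
- move=> x; rewrite divFE // /G exchange_big /=; apply: eq_bigr => x' _.
  by rewrite -Fd (divFE _ fF) [RHS](partition_big phi predT).
- apply: (@le_trans _ _ (4 `^ q * cost F)); last first.
    apply: (@le_trans _ _ (4 `^ q * c)); first by rewrite ler_wpM2l ?powR_ge0.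
    apply: ler_wpM2r; first exact: le_trans (cost_ge0 F) Fc.
    by rewrite /dilation ler_peMl ?powR_ge0 // ler1n.
  have -> : cost F = \sum_x \sum_y \sum_(x' | phi x' == x)
                     \sum_(y' | phi y' == y) `|F x' y'| `^ q.
    rewrite /cost (partition_big phi predT) //=; apply: eq_bigr => x _.
    rewrite [RHS]exchange_big /=; apply: eq_bigr => x' _.
    by rewrite [LHS](partition_big phi predT).
  rewrite mulr_sumr; apply: ler_sum => x _; rewrite mulr_sumr.
  apply: ler_sum => y _; rewrite /G !pair_big /=.
  apply: (@powR_sum_le _ _ _ 4).
  rewrite (_ : 4 = 2 * 2)%N //.
  have -> : #|(fun p : V * V => (phi p.1 == x) && (phi p.2 == y))| =
     (#|[pred a | phi a == x]| * #|[pred a | phi a == y]|)%N.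
    by rewrite -cardX; apply: eq_card => -[].
  exact: leq_mul.
Qed.

End PushForward.
End PowerSums.

(** * Words *)

Lemma connect_homo (V W : finType) (e : rel V) (e' : rel W) (h : V -> W) :
  (forall x y, e x y -> connect e' (h x) (h y)) ->
  forall x y, connect e x y -> connect e' (h x) (h y).
Proof.
move=> he x y /connectP [s es ->] {y}; elim: s x es => [|y s IHs] x /=.
  by rewrite connect0.
by case/andP=> /he xy /IHs; exact: connect_trans.
Qed.

Section Words.
Variable sys : IGS.
Local Notation S := (S_ sys).
Local Notation T := (T_ sys).
Implicit Types (a b x y : S) (w v : seq S) (t : T).

Definition adj a b := E0 a b || E0 b a.

(** The unoriented form of a gluing rule, since the symmetries may reverse edges. *)
Definition glued a b x y :=
  if E0 a b then Irule (typ a b) x y else Irule (typ b a) y x.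

(* The edges of the replacement graphs, read from the first letter on: the
   letters following the first disagreement are paired by one gluing rule. *)
Fixpoint word_edge w v : bool :=
  match w, v with
  | a :: w', b :: v' =>
      if a == b then word_edge w' v' else adj a b && all2 (glued a b) w' v'
  | _, _ => false
  end.

Fixpoint word_type w v : option T :=
  match w, v with
  | a :: w', b :: v' =>
      if a == b then word_type w' v'
      else if E0 a b && all2 (Irule (typ a b)) w' v' then Some (typ a b)
      else None
  | _, _ => None
  end.

Lemma all2_sym (r r' : rel S) w v :
  (forall x y, r x y = r' y x) -> all2 r w v = all2 r' v w.
Proof. by move=> rr; elim: w v => [|x w IHw] [|y v] //=; rewrite rr IHw. Qed.

Lemma all2_rcons (r : rel S) w v a b : size w = size v ->
  all2 r (rcons w a) (rcons v b) = all2 r w v && r a b.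
Proof.
elim: w v => [|x w IHw] [|y v] //= => [_|[/IHw ->]]; last by rewrite andbA.
by rewrite andbT.
Qed.

(** Enough for the letterwise action to preserve the edges of every replacement graph; types and
    orientations may change. *)
Definition letter_sym (s : S -> S) :=
  [/\ injective s, forall a b, adj a b -> adj (s a) (s b) &
      forall a b x y, adj a b -> glued a b x y ->
        glued (s a) (s b) (s x) (s y)].

Lemma letter_sym_comp s1 s2 :
  letter_sym s1 -> letter_sym s2 -> letter_sym (s1 \o s2).
Proof.
move=> [i1 a1 g1] [i2 a2 g2]; split; first exact: inj_comp.
  by move=> a b /a2 /a1.
by move=> a b x y ab /(g2 _ _ _ _ ab) /(g1 _ _ _ _ (a2 _ _ ab)).
Qed.

Lemma word_edge_map s w v :
  letter_sym s -> word_edge w v -> word_edge (map s w) (map s v).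
Proof.
move=> [si sa sg]; elim: w v => [|a w IHw] [|b v] //=; rewrite (inj_eq si).
case: ifP => _; first exact: IHw.
case/andP=> ab; rewrite sa //=; elim: w v {IHw} => [|x w IHw] [|y v] //=.
by case/andP=> xy /IHw ->; rewrite andbT; exact: sg.
Qed.

Hypothesis E0_asym : forall a b, E0 a b -> ~~ E0 b a.

Lemma E0_irr a : E0 a a = false.
Proof. by apply/negP => aa; have := E0_asym aa; rewrite aa. Qed.

(** Reconciles the two recursions: a new last letter either is the first disagreement, which is
    clause (1), or is paired by the rule of a type fixed earlier, which is clause (2). *)
Lemma word_type_rcons w v a b : size w = size v ->
  word_type (rcons w a) (rcons v b) =
  if w == v then (if E0 a b then Some (typ a b) else None)
  else if word_type w v is Some t then
         (if Irule t a b then Some t else None) else None.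
Proof.
elim: w v => [|c w IHw] [|d v] //=.
  move=> _; rewrite andbT; case: (eqVneq a b) => [->|//]; by rewrite E0_irr.
case=> wv; rewrite eqseq_cons; case: (eqVneq c d) => [_|ncd] /=.
  exact: IHw.
rewrite all2_rcons //; case: (E0 c d) => //=.
by case: (all2 _ w v).
Qed.

Lemma etype_revE w v : size w = size v ->
  etype_rev (rev w) (rev v) = word_type w v.
Proof.
elim/last_ind: w v => [|w a IHw] v; elim/last_ind: v => [|v b _] //;
  rewrite ?size_rcons // => -[wv].
by rewrite word_type_rcons // !rev_rcons /= IHw // (inj_eq (can_inj revK)).
Qed.

Lemma word_edgeE w v : size w = size v ->
  word_edge w v = (word_type w v != None) || (word_type v w != None).
Proof.
elim: w v => [|a w IHw] [|b v] //= [wv]; rewrite [b == a]eq_sym.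
case: ifP => [_|_]; first exact: IHw.
rewrite /adj /glued; case: (boolP (E0 a b)) => [ab|nab] /=.
  by rewrite (negbTE (E0_asym ab)) /= orbF; case: all2.
case: (E0 b a) => //=.
by rewrite (@all2_sym _ (Irule (typ b a))) //; case: all2.
Qed.

Lemma uedge_words m (w v : m.-tuple S) : uedge (@Em sys m) w v = word_edge w v.
Proof. by rewrite /uedge /Em !etype_revE ?size_tuple // word_edgeE ?size_tuple. Qed.

(** By induction each copy of the previous graph, given by a first letter, is connected; the copies
    of [a] and [r a] are joined by an edge, and iterating [r] reaches every copy. *)
Lemma Em_connected (r : S -> S) :
  (forall a, E0 a (r a) || E0 (r a) a) ->
  (forall a, exists x y, glued a (r a) x y) ->
  (forall a b, exists k, b = iter k r a) ->
  forall m (w v : m.-tuple S), connect (uedge (@Em sys m)) w v.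
Proof.
move=> radj rglued rtr; elim=> [|m IHm] w v.
  by rewrite (tuple0 w) (tuple0 v) connect0.
have copy a (w' v' : m.-tuple S) : connect (uedge (@Em sys m.+1))
    [tuple of a :: w'] [tuple of a :: v'].
  apply: (connect_homo (h := fun u : m.-tuple S => [tuple of a :: u])) (IHm _ _).
  move=> x y; rewrite uedge_words => xy; apply: connect1.
  by rewrite uedge_words /= eqxx.
have hop a (w' v' : m.-tuple S) : connect (uedge (@Em sys m.+1))
    [tuple of a :: w'] [tuple of r a :: v'].
  (* Constant words on a glued pair of letters give an edge between the two copies at every
     length. *)
  have [x [y xy]] := rglued a.
  apply: connect_trans (copy a w' [tuple of nseq m x]) _.
  apply: connect_trans _ (copy (r a) [tuple of nseq m y] v').
  apply: connect1; rewrite uedge_words /=.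
  have -> : (a == r a) = false.
    by apply/eqP => e; have := radj a; rewrite -e E0_irr.
  rewrite /adj radj /=; elim: (m) => //= k ->; by rewrite xy.
case/tupleP: w => a w; case/tupleP: v => b v; have [k ->] := rtr a b.
elim: k v => [|k IHk] v /=; first exact: copy.
exact: connect_trans (IHk v) (hop _ _ _).
Qed.

(** * Bounded degree of the replacement graphs *)

Section Degree.
Hypotheses (typ_inj : forall a b a' b', E0 a b -> E0 a' b' ->
              typ a b = typ a' b' -> a = a' /\ b = b')
  (rule_fun : forall t x y y', Irule t x y -> Irule t x y' -> y = y')
  (rule_inj : forall t x x' y, Irule t x y -> Irule t x' y -> x = x')
  (rule_out : forall a b y, E0 a b -> ~~ Irule (typ a b) a y)
  (rule_in : forall a b x, E0 a b -> ~~ Irule (typ a b) x b).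

(** By [rule_out], a letter starting an edge of type [t] is never a first coordinate of the rule of
    [t], so the two clauses cannot both supply an out-neighbour of the same type. *)
Lemma etype_rev_fun w v v' t :
  etype_rev w v = Some t -> etype_rev w v' = Some t -> v = v'.
Proof.
elim: w v v' t => [|a w IHw] [|b v] [|b' v'] t //=.
case: eqP => [<-|_]; case: eqP => [<-|_].
- by case: ifP => // ab [<-]; case: ifP => // ab' [/(typ_inj ab' ab)[_ ->]].
- case: ifP => // ab [<-]; case: etype_rev => // t'; case: ifP => // + [et].
  by rewrite et (negbTE (rule_out _ ab)).
- case: etype_rev => // t'; case: ifP => // + [<-]; case: ifP => // ab' + [et].
  by rewrite -et (negbTE (rule_out _ ab')).
- case e: (etype_rev w v) => [t1|//]; case: ifP => // i1 [<-].
  case e': (etype_rev w v') => [t2|//]; case: ifP => // i2 [et].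
  rewrite et in e' i2; by rewrite (IHw _ _ _ e e') (rule_fun i1 i2).
Qed.

Lemma etype_rev_inj w w' v t :
  etype_rev w v = Some t -> etype_rev w' v = Some t -> w = w'.
Proof.
elim: v w w' t => [|b v IHv] [|a w] [|a' w'] t //=.
case: eqP => [->|_]; case: eqP => [->|_].
- by case: ifP => // ab [<-]; case: ifP => // ab' [/(typ_inj ab' ab)[->]].
- case: ifP => // ab [<-]; case: etype_rev => // t'; case: ifP => // + [et].
  by rewrite et (negbTE (rule_in _ ab)).
- case: etype_rev => // t'; case: ifP => // + [<-]; case: ifP => // ab' + [et].
  by rewrite -et (negbTE (rule_in _ ab')).
- case e: (etype_rev w v) => [t1|//]; case: ifP => // i1 [<-].
  case e': (etype_rev w' v) => [t2|//]; case: ifP => // i2 [et].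
  rewrite et in e' i2; by rewrite (IHv _ _ _ e e') (rule_inj i1 i2).
Qed.

(** A neighbour is determined by the types of the edges in the two directions, at least one of which
    exists. *)
Lemma degree_bound m (w : m.-tuple S) :
  (#|uedge (@Em sys m) w| <= #|{: option T * option T}|)%N.
Proof.
pose h (v : m.-tuple S) :=
  (etype_rev (rev w) (rev v), etype_rev (rev v) (rev w)).
apply: (@leq_card_in _ _ h); move=> v v'; rewrite -!topredE /= /uedge /Em.
case e1: (etype_rev (rev w) (rev v)) => [t|] wv wv' [h1 h2].
  apply/val_inj/(can_inj revK); exact: etype_rev_fun e1 (etrans (esym h1) e1).
case e2: (etype_rev (rev v) (rev w)) wv => [t|] //= _.
apply/val_inj/(can_inj revK); exact: etype_rev_inj e2 (etrans (esym h2) e2).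
Qed.

End Degree.
End Words.

(** * Flow bases from profiles *)

Section TildeLift.
Variables (R : realType) (sys : IGS) (m : nat).
Local Notation W := (m.-tuple (S_ sys)).
Implicit Types (L : {set W}) (w v : W) (s : tsym sys m).

Lemma sum_tsym L (G : W -> R) : L \in Lm sys m ->
  \sum_(s : tsym sys m | (val s).1 == L) G (val s).2 = \sum_(w in L) G w.
Proof.
move=> LL.
rewrite [RHS](reindex_omap (fun s => (val s).2)
  (fun w => insub (L, w) : option (tsym sys m))) /=; last first.
  by move=> w wL; rewrite insubT //= LL.
apply: eq_bigl => s; case: s => -[M w] /= p; have /andP[/= ML wM] := p.
apply/eqP/andP => [ML'|[wL /eqP]].
  by subst M; split=> //; apply/eqP; rewrite insubT; congr Some; exact: val_inj.
by case: insubP => // u _ uv [e]; move: uv; rewrite e => -[].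
Qed.

Variable f : {set W} -> W -> R.

(** One profile [f L] serves the side [L] as source and as sink, whatever the other side is; (FB2)
    and (FB3) then hold by construction. *)
Definition port L1 L2 s : R :=
  if (val s).1 == L1 then f L1 (val s).2
  else if (val s).1 == L2 then - f L2 (val s).2 else 0.

Definition lift_flow (Phi : W -> W -> R) L1 L2 (x y : tV sys m) : R :=
  match x, y with
  | inl w, inl v => Phi w v
  | inr s, inl v => if (val s).2 == v then port L1 L2 s else 0
  | inl v, inr s => if (val s).2 == v then - port L1 L2 s else 0
  | inr _, inr _ => 0
  end.

Hypothesis f_supp : forall L w, L \in Lm sys m -> w \notin L -> f L w = 0.
Hypothesis f_sum : forall L, L \in Lm sys m -> \sum_(w in L) f L w = 1.

Lemma sum_port (G : R -> W -> R) L1 L2 :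
  (forall w, G 0 w = 0) -> L1 \in Lm sys m -> L2 \in Lm sys m -> L1 != L2 ->
  \sum_s G (port L1 L2 s) (val s).2 =
  \sum_(w in L1) G (f L1 w) w + \sum_(w in L2) G (- f L2 w) w.
Proof.
move=> G0 L1L L2L L12; rewrite (bigID (fun s => (val s).1 == L1)) /=.
congr (_ + _).
  rewrite -(sum_tsym (fun w => G (f L1 w) w)) //; apply: eq_bigr => s.
  by rewrite /port => ->.
rewrite -(sum_tsym (fun w => G (- f L2 w) w)) // big_mkcond [RHS]big_mkcond.
apply: eq_bigr => s _; rewrite /port; case: (eqVneq _ L1) => [->|n1] /=.
  by rewrite (negbTE L12).
by case: ifP => _; rewrite ?G0.
Qed.

(** At a word the added edges cancel the divergence of [Phi]; at a formal symbol the only edge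
    carries [port]. *)
Lemma lift_unit_flow Phi L1 L2 :
  L1 \in Lm sys m -> L2 \in Lm sys m -> L1 != L2 ->
  flow_fn (@Em sys m) Phi ->
  (forall w, divF (@Em sys m) Phi w = f L1 w - f L2 w) ->
  is_unit_flow (@tE sys m) (tildeL L1) (tildeL L2) (lift_flow Phi L1 L2).
Proof.
move=> L1L L2L L12 fPhi dPhi; have [aP P0] := fPhi.
have fl : flow_fn (@tE sys m) (lift_flow Phi L1 L2).
  split=> [[w|s] [v|s']|[w|s] [v|s']] //=; rewrite ?oppr0 //.
  - by case: ifP; rewrite ?oppr0.
  - by case: ifP; rewrite ?opprK ?oppr0.
  - exact: P0.
  - by rewrite /uedge /= => /negbTE ->.
  - by rewrite /uedge /= orbF => /negbTE ->.
have div_inr s : divF (@tE sys m) (lift_flow Phi L1 L2) (inr s) = port L1 L2 s.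
  rewrite divFE // big_sumType /= [X in _ + X]big1 // addr0 -big_mkcond /=.
  by rewrite (big_pred1 (val s).2) // => v /=; rewrite eq_sym.
have div_inl w : divF (@tE sys m) (lift_flow Phi L1 L2) (inl w) = 0.
  rewrite divFE // big_sumType /= -(divFE _ fPhi) dPhi.
  rewrite (@sum_port (fun r v => if v == w then - r else 0)) //; last first.
    by move=> v; rewrite oppr0 if_same.
  rewrite -!big_mkcondr /=.
  have one L (c : R) : L \in Lm sys m ->
      \sum_(v in L | v == w) (c * f L v) = c * f L w.
    move=> LL; case: (boolP (w \in L)) => wL.
      by rewrite (big_pred1 w) // => v /=; case: eqVneq => [->|]; rewrite ?wL ?andbF.
    rewrite (f_supp LL wL) mulr0 big1 // => v /andP[vL /eqP vw].
    by rewrite -vw vL in wL.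
  rewrite (eq_bigr (fun v => -1 * f L1 v)) => [|v _]; last by rewrite mulN1r.
  rewrite one // (eq_bigr (fun v => 1 * f L2 v)) => [|v _].
    by rewrite one //; lra.
  by rewrite opprK mul1r.
have sum_tilde L (h : tV sys m -> R) : L \in Lm sys m ->
    \sum_(x in tildeL L) h x = \sum_(s | (val s).1 == L) h (inr s).
  move=> LL; rewrite big_sumType /= big1 ?add0r; last by move=> w; rewrite inE.
  by apply: eq_bigl => s; rewrite inE.
(* A side is non-empty because its profile has total mass one. *)
have neq0 L : L \in Lm sys m -> tildeL L != finset.set0.
  move=> LL; apply/negP => /eqP L0.
  have := sum_tsym (f L) LL; rewrite f_sum //.
  rewrite -(@sum_tilde L (fun x => if x is inr s then f L (val s).2 else 0)) //.
  by rewrite L0 big_set0 => /eqP; rewrite eq_sym oner_eq0.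
split; last first.
  rewrite sum_tilde // -(f_sum L1L) -(sum_tsym _ L1L); apply: eq_bigr => s e.
  by rewrite div_inr /port e.
split=> //; try exact: neq0.
- apply/pred0P => -[w|s] /=; rewrite !inE //.
  by case: eqVneq => //= ->; rewrite (negbTE L12).
- move=> [w|s] //; rewrite !inE div_inr /port => /negbTE -> /negbTE -> //.
Qed.

Variable q : R.
Hypothesis q1 : 1 <= q.

Lemma energy_lift Phi L1 L2 :
  L1 \in Lm sys m -> L2 \in Lm sys m -> L1 != L2 ->
  energy (@tE sys m) q (lift_flow Phi L1 L2) <=
  cost q Phi + \sum_w `|f L1 w| `^ q + \sum_w `|f L2 w| `^ q.
Proof.
move=> L1L L2L L12; rewrite /energy big_sumType /= -addrA; apply: lerD.
  apply: le_trans (energy_le_cost q (@Em sys m) Phi); apply: ler_sum => w _.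
  by rewrite big_sumType /= [X in _ + X]big1 ?addr0.
under eq_bigr => s _.
  rewrite big_sumType /= [X in _ + X]big1 ?addr0 //.
  under eq_bigr => v -> do [].
  rewrite (big_pred1 (val s).2); last by move=> v /=; rewrite eq_sym.
  over.
rewrite (@sum_port (fun r _ => `|r| `^ q)) //; last first.
  by move=> _; rewrite normr0 powR0 // gt_eqF // (lt_le_trans _ q1).
under [\sum_(w in L2) _]eq_bigr do rewrite normrN.
have le L : \sum_(w in L) `|f L w| `^ q <= \sum_w `|f L w| `^ q.
  rewrite [leRHS](bigID (mem L)) /= lerDl.
  by apply: sumr_ge0 => w _; exact: powR_ge0.
by apply: lerD.
Qed.

(** Flip invariance of the profiles gives (FB4). The factor 3 counts the flow inside [G_m] and the
    two profiles on the added edges. *)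
Lemma flow_basis_of_profiles (K : R) :
  (forall (t : T_ sys) b, Iwm m t b != Iwm m t (~~ b)) ->
  (forall t b w, w \in Iwm m t b ->
     f (Iwm m t (~~ b)) (eta_m t w) = f (Iwm m t b) w) ->
  (forall L, \sum_w `|f L w| `^ q <= K) ->
  (forall L1 L2, transport q (@Em sys m) K (fun w => f L1 w - f L2 w)) ->
  exists FB : {set W} -> {set W} -> tV sys m -> tV sys m -> R,
    is_flow_basis FB /\ FB_energy q FB <= 3 * K.
Proof.
move=> side_neq f_flip f_pow tr.
have /choice [Phi hPhi] : forall p : {set W} * {set W}, exists F,
    [/\ flow_fn (@Em sys m) F,
        forall w, divF (@Em sys m) F w = f p.1 w - f p.2 w & cost q F <= K].
  by move=> p; exact: tr.
exists (fun L1 L2 => lift_flow (Phi (L1, L2)) L1 L2); split; last first.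
  (* The maxima in [FB_energy] start from [0]. *)
  have K0 : 0 <= 3 * K.
    have [_ _ h] := hPhi (finset.set0, finset.set0).
    by rewrite mulr_ge0 // (le_trans _ h) // cost_ge0.
  apply: bigmax_le => // L1 L1L; apply: bigmax_le => // L2 /andP[L2L L12].
  apply: le_trans (energy_lift _ L1L L2L L12) _.
  have [_ _ h] := hPhi (L1, L2); have := f_pow L1; have := f_pow L2; lra.
split; last split; last split.
- move=> L1 L2 L1L L2L L12; have [h1 h2 _] := hPhi (L1, L2).
  exact: lift_unit_flow.
- move=> L1 L2 s _ _ _ n1 n2 /=.
  by rewrite eqxx /port (negbTE n1) (negbTE n2).
- move=> L1 L2 s _ _ n1 n2 /=; rewrite !eqxx /port !eqxx.
  by rewrite (negbTE n1) (negbTE n2).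
- move=> t b s1 s2 e1 e2 e /=; rewrite !eqxx /port e1 e2 !eqxx.
  have n := side_neq t b; rewrite (negbTE n) eq_sym (negbTE n) !opprK e.
  split=> //; rewrite f_flip // -e1.
  by case: (s1) => -[? ?] /= /andP[].
Qed.

End TildeLift.

(** * Unit flows of nearly minimal energy *)

Section UnitFlows.
Variables (R : realType) (q : R) (V : finType) (E : rel V).
Hypothesis q1 : 1 <= q.

(** One unit is sent along a path, edge by edge; [G] is the flow across the first edge. *)
Lemma connect_flow (x y : V) : connect (uedge E) x y ->
  exists F : V -> V -> R, flow_fn E F /\
    forall z, divF E F z = (z == x)%:R - (z == y)%:R.
Proof.
case/connectP => s es -> {y}; elim: s x es => [|y s IHs] x /=.
  move=> _; exists (fun _ _ => 0); split; first by split=> *; rewrite ?oppr0.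
  by move=> z; rewrite /divF big1 // subrr.
case/andP=> xy /IHs [F [[aF F0] Fd]].
pose G u v : R := ((u == x) && (v == y))%:R - ((u == y) && (v == x))%:R.
have aG u v : G u v = - G v u.
  by rewrite /G opprB; congr (_%:R - _%:R); rewrite andbC.
have fG : flow_fn E G.
  split=> // u v n; rewrite /G.
  have -> : (u == x) && (v == y) = false.
    by apply/negP => /andP[/eqP eu /eqP ev]; rewrite eu ev xy in n.
  have -> : (u == y) && (v == x) = false; last exact: subrr.
  by apply/negP => /andP[/eqP eu /eqP ev]; move: n; rewrite eu ev /uedge orbC => /negP.
exists (fun u v => G u v + F u v); split.
  split=> [u v|u v n]; first by rewrite (aF u) (aG u) [RHS]opprD.
  by rewrite F0 // (proj2 fG) // addr0.
move=> z; rewrite /divF big_split /= -/(divF E F z) -/(divF E G z) Fd.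
have sum1 (P : bool) (v : V) : \sum_y (P && (y == v))%:R = P%:R :> R.
  case: P; rewrite /=; last by rewrite big1.
  by rewrite (bigD1 v) //= eqxx big1 ?addr0 // => u /negbTE ->.
by rewrite divFE // /G sumrB !sum1 addrA subrK.
Qed.

(** The unit leaving [A] is a sum of at most [#|V * V|] values of [F]. The bound depends on the
    graph and serves to make the infimum positive. *)
Lemma unit_flow_energy_ge (A B : {set V}) F : is_unit_flow E A B F ->
  (2 * #|{: V * V}|%:R `^ q)^-1 <= energy E q F.
Proof.
move=> [[_ _ _ fF _] F1].
have le1 : 1 <= #|{: V * V}|%:R `^ q * cost q F.
  have s1 : \sum_(p : V * V | p.1 \in A) F p.1 p.2 = 1.
    rewrite -F1; under [RHS]eq_bigr do rewrite divFE //.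
    by rewrite pair_big; apply: eq_bigl => p; rewrite andbT.
  have := powR_sum_le q1 (fun p => F p.1 p.2)
    (max_card (fun p : V * V => p.1 \in A)).
  rewrite s1 normr1 powR1 => /le_trans; apply.
  rewrite ler_wpM2l ?powR_ge0 // /cost pair_big /=.
  rewrite [leRHS](bigID (fun p => p.1 \in A)) /= lerDl.
  by apply: sumr_ge0 => p _; exact: powR_ge0.
have N0 : 0 <= #|{: V * V}|%:R `^ q :> R by exact: powR_ge0.
have {}le1 : 1 <= (2 * #|{: V * V}|%:R `^ q) * energy E q F.
  apply: le_trans le1 _; rewrite [2 * _]mulrC -mulrA ler_wpM2l //.
  exact: cost_le_energy.
have N1 : 0 < 2 * #|{: V * V}|%:R `^ q :> R.
  rewrite lt_neqAle mulr_ge0 // andbT; apply/eqP => e.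
  by move: le1; rewrite -e mul0r ler10.
by rewrite -[leLHS]mulr1 ler_pdivrMl.
Qed.

Lemma Eq_res_approx (A B : {set V}) :
  (exists F : V -> V -> R, is_unit_flow E A B F) ->
  exists F : V -> V -> R, is_unit_flow E A B F /\
    energy E q F <= 2 * Eq_res E q A B.
Proof.
move=> [F0 F0u]; have [uV|] := posnP #|{: V * V}|.
  have [[_ A0 _ _ _] _] := F0u; case/set0Pn: A0 => x _.
  by have := card0_eq uV (x, x).
move=> N0; set es := [set e | exists F, is_unit_flow E A B F /\ e = energy E q F]%classic.
pose c : R := (2 * #|{: V * V}|%:R `^ q)^-1.
have c0 : 0 < c.
  by rewrite invr_gt0 mulr_gt0 //; apply: powR_gt0; rewrite ltr0n.
have lbc : lbound es c by move=> e [F [Fu ->]]; exact: unit_flow_energy_ge Fu.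
have ne : (es !=set0)%classic by exists (energy E q F0), F0.
have hi : has_inf es by split=> //; exists c.
have i0 : 0 < inf es by apply: lt_le_trans c0 _; exact: lb_le_inf.
(* The tolerance of the approximation is the infimum itself, hence the factor 2. *)
have [e [F [Fu ->]] lt] := inf_adherent i0 hi.
exists F; split=> //; rewrite /Eq_res -/es; apply: ltW; apply: lt_le_trans lt _.
lra.
Qed.

End UnitFlows.

(** * Dihedral systems *)

(** A divergence is a sum of at most [D] edge values. This will bound the energy of a profile on the
    added edges. *)
Lemma transport_norm (R : realType) (q : R) (V : finType) (E : rel V)
    (D : nat) (c : R) (d : V -> R) :
  1 <= q -> (forall x, (#|uedge E x| <= D)%N) -> transport q E c d ->
  \sum_x `|d x| `^ q <= D%:R `^ q * c.
Proof.
move=> q1 deg [F [fF Fd Fc]].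
apply: (@le_trans _ _ (D%:R `^ q * cost q F)); last first.
  by rewrite ler_wpM2l ?powR_ge0.
rewrite mulr_sumr; apply: ler_sum => x _; rewrite -Fd.
apply: le_trans (powR_sum_le q1 _ (deg x)) _; rewrite ler_wpM2l ?powR_ge0 //.
rewrite [leRHS](bigID (uedge E x)) /= lerDl.
by apply: sumr_ge0 => y _; exact: powR_ge0.
Qed.

Lemma powR_half_le (R : realType) (q a b : R) : 1 <= q ->
  `|2^-1 * (a + b)| `^ q <= `|a| `^ q + `|b| `^ q.
Proof.
move=> q1; have q0 : 0 <= q by exact: le_trans q1.
wlog ab : a b / `|a| <= `|b|.
  move=> H; case/orP: (le_total `|a| `|b|) => /H //.
  by rewrite addrC [X in _ <= X]addrC.
apply: (@le_trans _ _ (`|b| `^ q)); last by rewrite lerDr powR_ge0.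
apply: ge0_ler_powR; rewrite ?nnegrE //.
rewrite normrM gtr0_norm // ler_pdivrMl //.
by apply: le_trans (ler_normD _ _) _; lra.
Qed.

(* [rot] and [tau] are letter symmetries generating a dihedral group, [tau]
   preserves the side [Iside t0 false], and [Iside t b] is the image of that
   side under the [idx t b]-th power of [rot].  The map [fold] reflects part of
   the graph onto the rest so as to carry the side [Iside t0 true] next to
   [Iside t0 false]. *)
Record dihedral_system (sys : IGS) (t0 : T_ sys) (rot tau : S_ sys -> S_ sys)
    (idx : T_ sys -> bool -> nat) : Prop := {
  E0_asymmetric : forall a b : S_ sys, E0 a b -> ~~ E0 b a;
  typ_injective : forall a b a' b' : S_ sys, E0 a b -> E0 a' b' ->
    typ a b = typ a' b' -> a = a' /\ b = b';
  rule_functional : forall (t : T_ sys) x y y',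
    Irule t x y -> Irule t x y' -> y = y';
  rule_injective : forall (t : T_ sys) x x' y,
    Irule t x y -> Irule t x' y -> x = x';
  rule_source : forall a b y : S_ sys, E0 a b -> ~~ Irule (typ a b) a y;
  rule_target : forall a b x : S_ sys, E0 a b -> ~~ Irule (typ a b) x b;
  rot_sym : letter_sym rot;
  rot_adj : forall a, adj a (rot a);
  rot_glued : forall a, exists x y, glued a (rot a) x y;
  rot_transitive : forall a b, exists k, b = iter k rot a;
  tau_sym : letter_sym tau;
  tau_involutive : involutive tau;
  rot_tau : forall x, rot (tau (rot x)) = tau x;
  tau_side : forall x, x \in Iside t0 false -> tau x \in Iside t0 false;
  flip_sym : letter_sym (Defs.eta t0);
  flip_involutive : involutive (Defs.eta t0);
  flip_side : forall b x, x \in Iside t0 b -> Defs.eta t0 x \in Iside t0 (~~ b);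
  side_disjoint : forall (t : T_ sys) x, x \in Iside t true ->
    x \notin Iside t false;
  side_nonempty : forall (t : T_ sys) b, exists x, x \in Iside t b;
  side_idx : forall (t : T_ sys) b x, x \in Iside t0 false ->
    iter (idx t b) rot x \in Iside t b;
  flip_idx : forall (t : T_ sys) b x,
    Defs.eta t (iter (idx t b) rot x) = iter (idx t (~~ b)) rot (tau x);
  idx_inj : forall t b t' b',
    (forall x, (x \in Iside t b) = (x \in Iside t' b')) -> idx t b = idx t' b';
  idx_lt : forall t b, (idx t b < 5)%N;
  side_reduce : forall t : T_ sys, exists2 s, letter_sym s &
    forall b x, x \in Iside t b -> s x \in Iside t0 b;
  side_fold : exists (fold : seq (S_ sys) -> seq (S_ sys)) theta,
    [/\ forall w, size (fold w) = size w,
        forall w v, word_edge w v ->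
          word_edge (fold w) (fold v) \/ fold w = fold v,
        injective theta /\ forall w, fold w = w \/ fold w = map theta w,
        forall w, all (mem (Iside t0 false)) w -> fold w = w &
        forall w, all (mem (Iside t0 false)) w ->
          fold (map (Defs.eta t0) w) = map rot w]
}.

Section Dihedral.
Variables (R : realType) (q : R) (sys : IGS) (t0 : T_ sys).
Variables (rot tau : S_ sys -> S_ sys) (idx : T_ sys -> bool -> nat).
Hypotheses (q1 : 1 <= q) (D : dihedral_system t0 rot tau idx).
Variable m : nat.
Hypothesis m0 : (0 < m)%N.
Local Notation S := (S_ sys).
Local Notation W := (m.-tuple S).
Local Notation G := (@Em sys m).
Implicit Types (s : S -> S) (w : W) (d : W -> R).

Lemma in_Iwm (t : T_ sys) b w :
  (w \in Iwm m t b) = all (mem (Iside t b)) w.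
Proof. by rewrite inE. Qed.

Lemma map_Iwm (t t' : T_ sys) b b' s w :
  (forall x, x \in Iside t b -> s x \in Iside t' b') ->
  w \in Iwm m t b -> map_tuple s w \in Iwm m t' b'.
Proof.
rewrite !in_Iwm => h /allP wt; apply/allP => _ /mapP [x xw ->].
exact/h/wt.
Qed.

(** Through constant words a side of words determines the side of letters; at length 0 all sides of
    words coincide. *)
Lemma nseq_Iwm (t : T_ sys) b (x : S) :
  ([tuple of nseq m x] \in Iwm m t b) = (x \in Iside t b).
Proof. by rewrite in_Iwm all_nseq eqn0Ngt m0. Qed.

Lemma Iwm_disjoint (t : T_ sys) w : w \in Iwm m t true -> w \notin Iwm m t false.
Proof.
rewrite !in_Iwm => /allP w1; apply/negP => /allP w0.
have xw := mem_tnth (Ordinal m0) w.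
by move/negP: (side_disjoint D (w1 _ xw)); apply; exact: w0 xw.
Qed.

Lemma map_tuple_inj s : injective s -> injective (map_tuple s : W -> W).
Proof. by move=> si w v /(congr1 val) /(inj_map si) /val_inj. Qed.

Lemma map_tuple_comp s1 s2 w :
  map_tuple s1 (map_tuple s2 w) = map_tuple (s1 \o s2) w.
Proof. by apply: val_inj; rewrite /= map_comp. Qed.

Lemma eq_map_tuple s1 s2 w : s1 =1 s2 -> map_tuple s1 w = map_tuple s2 w.
Proof. by move=> e; apply: val_inj; exact: eq_map. Qed.

Lemma transport_sym c d s : letter_sym s -> transport q G c d ->
  transport q G (dilation q * c) (push (map_tuple s) d).
Proof.
move=> ss; have [si _ _] := ss; apply: transport_push => // [x y|x].
  rewrite !(uedge_words (E0_asymmetric D)) => xy; left; exact: word_edge_map.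
apply: leq_trans (_ : 1 <= 2)%N => //; apply/card_le1_eqP => u v.
rewrite !inE => /eqP <- /eqP e; exact/esym/(map_tuple_inj si).
Qed.

(** The fold fixes a word or applies the injection [theta], so the fibre over [x] contains at most
    [x] and one preimage under [theta]. *)
Lemma transport_fold c d : transport q G c d -> exists phi : W -> W,
  [/\ transport q G (dilation q * c) (push phi d),
      forall w, w \in Iwm m t0 false -> phi w = w &
      forall w, w \in Iwm m t0 false ->
        phi (map_tuple (Defs.eta t0) w) = map_tuple rot w].
Proof.
have [fold [theta [fsz fedge [thi fth] fid frot]]] := side_fold D.
have fP w : size (fold w) == m by rewrite fsz size_tuple.
pose phi w : W := Tuple (fP w); move=> tr; exists phi; split; first last.
- by move=> w; rewrite in_Iwm => /frot e; exact: val_inj.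
- by move=> w; rewrite in_Iwm => /fid e; exact: val_inj.
apply: transport_push tr => // [x y|x].
  rewrite !(uedge_words (E0_asymmetric D)) => /fedge [e|e]; [by left|right].
  exact: val_inj.
have sub : [pred y | phi y == x] \subset
    [predU pred1 x & [pred y | map_tuple theta y == x]].
  apply/fintype.subsetP => y; rewrite !inE => /eqP <-; case: (fth y) => e; apply/orP.
    by left; apply/eqP; apply: val_inj; rewrite /= e.
  by right; apply/eqP; apply: val_inj; rewrite /= e.
apply: leq_trans (subset_leq_card sub) _.
apply: leq_trans (leq_addr
  #|[predI pred1 x & [pred y | map_tuple theta y == x]]| _) _.
rewrite cardUI card1 add1n ltnS.
apply/card_le1_eqP => u v; rewrite !inE => /eqP <- /eqP e.
exact/esym/(map_tuple_inj thi).
Qed.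

(** * From one flow to a symmetric profile *)

Section Profile.
Variables (c : R) (d : W -> R).
Hypothesis d_tr : transport q G c d.
Hypothesis d_supp : forall w,
  w \notin Iwm m t0 false -> w \notin Iwm m t0 true -> d w = 0.
Hypothesis d_sum : \sum_(w in Iwm m t0 false) d w = 1.

Local Notation A := (Iwm m t0 false).
Local Notation B := (Iwm m t0 true).
(** The exponent counts the sums and push-forwards performed so far; scaling by a factor of modulus
    at most one is free. *)
Local Notation tn k := (transport q G (dilation q ^+ k * c)).

Let c0 : 0 <= c.
Proof. by case: d_tr => F [_ _]; apply: le_trans; exact: cost_ge0. Qed.

Let tn_le k k' d1 : (k <= k')%N -> tn k d1 -> tn k' d1.
Proof.
move=> kk; apply: transport_le; apply: ler_wpM2r => //.
by rewrite ler_weXn2l // dilation_ge1.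
Qed.

Let tn_add k d1 d2 : tn k d1 -> tn k d2 -> tn k.+1 (fun w => d1 w + d2 w).
Proof. by move=> *; rewrite exprS -mulrA; exact: transport_add. Qed.

Let tn_sym k d1 s : letter_sym s -> tn k d1 -> tn k.+1 (push (map_tuple s) d1).
Proof. by move=> *; rewrite exprS -mulrA; exact: transport_sym. Qed.

Let h w : W := map_tuple (Defs.eta t0) w.

Let hK : involutive h.
Proof.
move=> w; rewrite /h map_tuple_comp; apply: val_inj => /=.
by rewrite (eq_map (g := id)) ?map_id // => x /=; rewrite (flip_involutive D).
Qed.

Let pushh d1 w : push h d1 w = d1 (h w).
Proof. by rewrite -{1}(hK w) push_inj //; exact: inv_inj. Qed.

Let hA w : w \in A -> h w \in B.
Proof. by apply: map_Iwm; exact: (flip_side D). Qed.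

Let hB w : w \in B -> h w \in A.
Proof. by apply: map_Iwm; exact: (flip_side D). Qed.

Let half1 : `|2^-1 : R| <= 1. Proof. by rewrite gtr0_norm //; lra. Qed.

(** The odd part of [d] under the flip. *)
Let od w : R := 2^-1 * (d w - d (h w)).

Let od_tr : tn 2 od.
Proof.
have t1 : tn 0 d by rewrite expr0 mul1r.
have t2 : tn 1 (push h d) by apply: tn_sym t1; exact: (flip_sym D).
have {}t1 := transport_scale q1 half1 (tn_le (leq0n 1) t1).
have n1 : `|- 2^-1 : R| <= 1 by rewrite normrN.
have {}t2 := transport_scale q1 n1 t2.
by apply: transport_ext (tn_add t1 t2) => w; rewrite pushh /od; lra.
Qed.

Let g w : R := if w \in A then od w else 0.

Let g_supp w : w \notin A -> g w = 0.
Proof. by rewrite /g => /negbTE ->. Qed.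

(** The flip exchanges the disjoint sides [A] and [B], and [d] vanishes off both, so [od] on [B] is
    minus the mirror image of [od] on [A]. *)
Let odE w : od w = g w - push h g w.
Proof.
rewrite pushh /g; case: (boolP (w \in A)) => wA.
  case: ifP => [/hA|_]; last by rewrite subr0.
  by rewrite hK => /Iwm_disjoint; rewrite wA.
case: (boolP (w \in B)) => wB.
  by rewrite hB // /od hK; lra.
case: ifP => [/hA|hwA]; first by rewrite hK (negbTE wB).
rewrite /od !d_supp //; first by lra.
- by rewrite hwA.
- by apply: contra wA => /hB; rewrite hK.
Qed.

(** On [A] the fold is the identity and takes [h w] to the rotation of [w]; it thus turns the sink
    profile of [od] into the rotated source profile. *)
Let g_rot : tn 3 (fun w => g w - push (map_tuple rot) g w).
Proof.
have [phi [tr pA pB]] := transport_fold od_tr.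
rewrite exprS -mulrA; apply: transport_ext tr => w.
rewrite (eq_push _ odE) pushB push_comp; congr (_ - _).
  rewrite -[RHS]push_id; apply: eq_push_supp => v gv; apply: pA.
  by apply: contraR gv => /g_supp ->.
apply: eq_push_supp => v gv; apply: pB.
by apply: contraR gv => /g_supp ->.
Qed.

Let tm w : W := map_tuple tau w.

Let tmK : involutive tm.
Proof.
move=> w; rewrite /tm map_tuple_comp; apply: val_inj => /=.
by rewrite (eq_map (g := id)) ?map_id // => x /=; rewrite (tau_involutive D).
Qed.

Let f0 w : R := 2^-1 * (g w + push tm g w).

Let f0_tau w : f0 (tm w) = f0 w.
Proof.
rewrite /f0 push_inj; last exact: inv_inj.
rewrite addrC; congr (_ * (_ + _)).
by rewrite -{2}(tmK w) push_inj //; exact: inv_inj.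
Qed.

(** As [rot tau rot = tau], pushing the flow of [g_rot] by [tau] and then by [rot] gives one from
    [rot tau g] to [tau g]. Its reversal, averaged with the original, joins [f0] to its rotation. *)
Let f0_rot : tn 6 (fun w => f0 w - push (map_tuple rot) f0 w).
Proof.
have t3 := transport_scale q1 half1 (tn_le (isT : 3 <= 5)%N g_rot).
have t5 := tn_sym (rot_sym D) (tn_sym (tau_sym D) g_rot).
have n1 : `|- 2^-1 : R| <= 1 by rewrite normrN.
have {}t5 := transport_scale q1 n1 t5.
apply: transport_ext (tn_add t3 t5) => w.
have -> : push (map_tuple rot) f0 w = 2^-1 * (push (map_tuple rot) g w +
    push (map_tuple rot) (push tm g) w).
  by rewrite -pushD -pushZ.
have e : push (map_tuple rot) (push tm (push (map_tuple rot) g)) w = push tm g w.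
  rewrite !push_comp; apply: eq_push_supp => v _ /=.
  rewrite !map_tuple_comp; apply: eq_map_tuple => x /=; exact: (rot_tau D).
rewrite (eq_push _ (fun v => pushB _ _ _ v)) pushB e /f0; lra.
Qed.

Let fk k := push (map_tuple (iter k rot)) f0.

Let iter_sym k : letter_sym (iter k rot).
Proof.
elim: k => [|k IHk]; first by split.
exact: letter_sym_comp (rot_sym D) IHk.
Qed.

Let iter_inj k : injective (map_tuple (iter k rot) : W -> W).
Proof. by apply: map_tuple_inj; case: (iter_sym k). Qed.

(** Telescoping over successive rotations: a rotated copy of [f0_rot] has exponent 7, and each step
    adds one sum. *)
Let fk_tr0 k : tn (7 + k) (fun w => f0 w - fk k w).
Proof.
elim: k => [|k IHk].
  (* The zero divergence is obtained by scaling a flow by 0. *)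
  have z1 : `|0 : R| <= 1 by rewrite normr0.
  apply: transport_ext (transport_scale q1 z1 (tn_le (isT : 6 <= 7 + 0)%N f0_rot)).
  move=> w; rewrite mul0r /fk (eq_push_supp (psi := id)) ?push_id ?subrr //.
  by move=> v _; apply: val_inj; rewrite /= map_id.
have t7 := tn_le (leq_addr k 7) (tn_sym (iter_sym k) f0_rot).
apply: transport_ext (tn_add IHk t7) => w.
rewrite pushB push_comp -/(fk k w) addrA subrK; congr (_ - _).
apply: eq_push_supp => v _ /=; rewrite map_tuple_comp.
by apply: eq_map_tuple => x /=; rewrite -iterSr.
Qed.

(** Passing through [f0] takes exponent at most [7 + 4] for each half and one more sum. *)
Let fk_tr i j : (i < 5)%N -> (j < 5)%N -> tn 12 (fun w => fk i w - fk j w).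
Proof.
move=> i5 j5; have n1 : `|- 1 : R| <= 1 by rewrite normrN normr1.
have le11 k : (k < 5)%N -> (7 + k <= 11)%N by rewrite (leq_add2l 7 k 4).
have ti := transport_scale q1 n1 (tn_le (le11 i i5) (fk_tr0 i)).
have tj := tn_le (le11 j j5) (fk_tr0 j).
by apply: transport_ext (tn_add ti tj) => w; lra.
Qed.

Let deg := #|{: option (T_ sys) * option (T_ sys)}|.

(** Rotations preserve the norm, [g] restricts the divergence [od], and bounded degree controls the
    latter. The third dilation absorbs the factor 2 of the average with the [tau] image. *)
Let fk_norm k : \sum_w `|fk k w| `^ q <= deg%:R `^ q * (dilation q ^+ 3 * c).
Proof.
rewrite (sum_push (fun r => `|r| `^ q) f0 (@iter_inj k)).
apply: (@le_trans _ _ (2 * \sum_w `|g w| `^ q)).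
  rewrite mulr2n mulrDl mul1r -{2}(sum_push (fun r => `|r| `^ q) g (inv_inj tmK)).
  by rewrite -big_split; apply: ler_sum => w _; exact: powR_half_le.
apply: (@le_trans _ _ (2 * (deg%:R `^ q * (dilation q ^+ 2 * c)))).
  rewrite ler_pM2l //; apply: le_trans (transport_norm q1 _ od_tr); last first.
    move=> w; exact: (degree_bound (typ_injective D) (@rule_functional _ _ _ _ _ D)
     (@rule_injective _ _ _ _ _ D) (@rule_source _ _ _ _ _ D) (@rule_target _ _ _ _ _ D)).
  apply: ler_sum => w _; rewrite /g; case: ifP => // _.
  by rewrite normr0 powR0 ?powR_ge0 // gt_eqF // (lt_le_trans _ q1).
have := powR_dilation q1 (isT : 1 <= 4)%N; rewrite powR1 mulr1 => le2.
rewrite mulrCA ler_wpM2l ?powR_ge0 // [dilation q ^+ 3]exprS -[leRHS]mulrA.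
apply: ler_wpM2r => //; rewrite mulr_ge0 // exprn_ge0 //.
exact: le_trans (dilation_ge1 q1).
Qed.

Let f0_supp w : w \notin A -> f0 w = 0.
Proof.
move=> wA; rewrite /f0 g_supp // (push_supp g_supp _ wA) ?addr0 ?mulr0 //.
by move=> v; apply: map_Iwm; exact: (tau_side D).
Qed.

(** The total divergence is zero, so [d] has mass -1 on [B], and its odd part has mass [(1 + 1) / 2]
    on [A]. *)
Let sum_f0 : \sum_w f0 w = 1.
Proof.
rewrite -mulr_sumr big_split /= (sum_push id g (inv_inj tmK)).
have -> : \sum_w g w = \sum_(w in A) od w by rewrite -big_mkcond.
rewrite -mulr_sumr sumrB d_sum.
have -> : \sum_(w in A) d (h w) = \sum_(w in B) d w.
  rewrite [RHS](reindex_inj (inv_inj hK)); apply: eq_bigl => w.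
  by apply/idP/idP => [/hA|/hB] //; rewrite hK.
have : \sum_w d w = 0.
  case: d_tr => F [fF Fd _]; rewrite -[RHS](sum_divF fF).
  by apply: eq_bigr => w _; rewrite Fd.
rewrite (bigID (mem A)) /= d_sum (bigID (mem B)) /=.
rewrite [X in _ + (_ + X)]big1 ?addr0 => [|w /andP[wA wB]]; last exact: d_supp.
rewrite (eq_bigl (mem B)) => [|w /=]; first by lra.
by apply: andb_idl => /Iwm_disjoint.
Qed.

Lemma flow_basis_of_flow :
  exists FB : {set W} -> {set W} -> tV sys m -> tV sys m -> R,
    is_flow_basis FB /\
    FB_energy q FB <= 3 * (deg%:R `^ q * (dilation q ^+ 12 * c)).
Proof.
(* Different pairs of a type and a sign can give the same side, so the rotation index is attached to
   the set of words; [idx_inj] makes the choice immaterial. *)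
pose kL (L : {set W}) : nat :=
  if [pick p : T_ sys * bool | Iwm m p.1 p.2 == L] is Some p then idx p.1 p.2
  else 0%N.
have kL5 L : (kL L < 5)%N by rewrite /kL; case: pickP => // p _; exact: (idx_lt D).
have kLE t b : kL (Iwm m t b) = idx t b.
  rewrite /kL; case: pickP => [p /eqP e|/(_ (t, b))]; last by rewrite eqxx.
  by apply: (idx_inj D) => x; rewrite -!nseq_Iwm e.
pose f L := fk (kL L).
have f_supp L w : L \in Lm sys m -> w \notin L -> f L w = 0.
  case/imset2P=> t b _ _ ->; rewrite /f kLE; apply: push_supp; first exact: f0_supp.
  by move=> v; apply: map_Iwm; exact: (side_idx D).
have f_sum L : L \in Lm sys m -> \sum_(w in L) f L w = 1.
  move=> LL; rewrite -sum_f0 -(sum_push id f0 (@iter_inj (kL L))).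
  rewrite [RHS](bigID (mem L)) /= [X in _ + X]big1 ?addr0 //.
  by move=> w; exact: f_supp.
have deg1 : 1 <= deg%:R `^ q :> R.
  have e1 : (1 : R) `^ q = 1 by rewrite powR1.
  rewrite -[leLHS]e1; apply: ge0_ler_powR; rewrite ?nnegrE //; first exact: le_trans q1.
  by rewrite ler1n; apply/card_gt0P; exists (None, None).
have dil0 k : 0 <= dilation q ^+ k * c.
  by rewrite mulr_ge0 // exprn_ge0 // (le_trans _ (dilation_ge1 q1)).
apply: (@flow_basis_of_profiles _ _ _ f) => //.
- move=> t b; have [x xb] := side_nonempty D t b; apply/eqP => e.
  have := xb; rewrite -nseq_Iwm => y; have := y; rewrite e.
  by case: b {xb e} y => [/Iwm_disjoint/negP //|] /= + /Iwm_disjoint/negP.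
(* Write [w] as a rotation of [r' w]: the flip then acts as [tau] followed by another rotation, and
   [f0] is invariant under [tau]. *)
- move=> t b w _; rewrite /f !kLE /fk.
  have [r' _ rK] := injF_bij (@iter_inj (idx t b)); rewrite -(rK w).
  have -> : eta_m t (map_tuple (iter (idx t b) rot) (r' w)) =
            map_tuple (iter (idx t (~~ b)) rot) (tm (r' w)).
    rewrite /eta_m /tm !map_tuple_comp; apply: eq_map_tuple => x /=.
    exact: (flip_idx D).
  by rewrite !push_inj ?f0_tau //; exact: iter_inj.
- move=> L; apply: le_trans (fk_norm _) _; rewrite ler_wpM2l ?powR_ge0 //.
  by apply: ler_wpM2r => //; rewrite ler_weXn2l // dilation_ge1.
- move=> L1 L2; apply: transport_le (fk_tr (kL5 L1) (kL5 L2)).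
  by rewrite ler_peMl.
Qed.

End Profile.
End Dihedral.

(** One basis must serve all types. It is built from a type of least resistance, whose flow a letter
    symmetry carries to the sides of [t0]. *)
Lemma dihedral_flow_bases (R : realType) (q : R) (sys : IGS) (t0 : T_ sys)
    (rot tau : S_ sys -> S_ sys) (idx : T_ sys -> bool -> nat) :
  1 <= q -> dihedral_system t0 rot tau idx ->
  exists C : R, 0 < C /\ forall m : nat, (0 < m)%N ->
    exists FB : {set m.-tuple (S_ sys)} -> {set m.-tuple (S_ sys)} ->
                tV sys m -> tV sys m -> R,
      is_flow_basis FB /\
      forall t : T_ sys,
        FB_energy q FB <= C * Eq_res (@Em sys m) q (Iwm m t false) (Iwm m t true).
Proof.
move=> q1 D; pose deg := #|{: option (T_ sys) * option (T_ sys)}|.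
(* The 4 is 2 for near-optimality times 2 for passing from energy to cost; the separate dilation
   pays for moving the flow to [t0]. *)
pose C : R := 3 * (deg%:R `^ q * (dilation q ^+ 12 * (dilation q * 4))).
have C0 : 0 < C.
  have dil0 : 0 < dilation q by exact: lt_le_trans (dilation_ge1 q1).
  have deg0 : 0 < deg%:R `^ q :> R.
    by apply: powR_gt0; rewrite ltr0n; apply/card_gt0P; exists (None, None).
  by rewrite !mulr_gt0 // exprn_gt0.
exists C; split=> // m m0; pose res t := Eq_res (@Em sys m) q (Iwm m t false) (Iwm m t true).
have nonempty t : exists F : m.-tuple (S_ sys) -> m.-tuple (S_ sys) -> R,
    is_unit_flow (@Em sys m) (Iwm m t false) (Iwm m t true) F.
  have [x xI] := side_nonempty D t false; have [y yI] := side_nonempty D t true.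
  have xW : [tuple of nseq m x] \in Iwm m t false by rewrite nseq_Iwm.
  have yW : [tuple of nseq m y] \in Iwm m t true by rewrite nseq_Iwm.
  have /(connect_flow R) [F [fF Fd]] :=
    Em_connected (E0_asymmetric D) (rot_adj D) (rot_glued D) (rot_transitive D)
      [tuple of nseq m x] [tuple of nseq m y].
  exists F; split; first split=> //.
  - apply/pred0P => w /=; apply/negP => /andP[w0].
    by move/(Iwm_disjoint D m0); rewrite w0.
  - by apply/set0Pn; exists [tuple of nseq m x].
  - by apply/set0Pn; exists [tuple of nseq m y].
  - move=> w w0 w1; rewrite Fd.
    case: eqVneq => [e|_]; first by rewrite e xW in w0.
    by case: eqVneq => [e|_]; [rewrite e yW in w1 | rewrite subrr].
  - under eq_bigr do rewrite Fd.
    rewrite (bigD1 [tuple of nseq m x]) //= eqxx big1 => [|w /andP[w0 /negbTE ->]].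
      case: eqVneq => [e|_]; last by rewrite subr0 addr0.
      by have := Iwm_disjoint D m0 yW; rewrite -e xW.
    case: eqVneq => [e|_]; last by rewrite subr0.
    by have := Iwm_disjoint D m0 yW; rewrite -e w0.
case: (arg_minP res (isT : xpredT t0)) => t _ tmin.
have [F [[[_ _ _ fF F0] F1] Fe]] := Eq_res_approx q1 (nonempty t).
have [s ss sI] := side_reduce D t.
have [si _ _] := ss.
pose d := push (map_tuple s) (divF (@Em sys m) F).
have Fc : transport q (@Em sys m) (4 * res t) (divF (@Em sys m) F).
  exists F; split=> //; have := cost_le_energy q1 fF; rewrite -/(res t) in Fe; lra.
have d_tr := transport_sym q1 D ss Fc.
have sW b (w : m.-tuple (S_ sys)) :
    w \in Iwm m t b -> map_tuple s w \in Iwm m t0 b by apply: map_Iwm; exact: sI.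
have d_supp w : w \notin Iwm m t0 false -> w \notin Iwm m t0 true -> d w = 0.
  move=> w0 w1; apply: big1 => v /eqP vw.
  by apply: F0; [apply: contra w0 => /sW | apply: contra w1 => /sW]; rewrite vw.
have d_sum : \sum_(w in Iwm m t0 false) d w = 1.
  have sinj : injective (map_tuple s : m.-tuple _ -> _) by exact: map_tuple_inj.
  rewrite -[RHS]F1 (reindex_inj sinj) /=.
  under eq_bigr do rewrite /d (push_inj _ _ sinj).
  rewrite [LHS]big_mkcond [RHS]big_mkcond /=; apply: eq_bigr => w _.
  (* A word off the source side of [t] whose image lies on that of [t0] is not on the sink side of
     [t] either, so its divergence is zero. *)
  case: (boolP (w \in Iwm m t false)) => [/sW -> //|w0].
  case: ifP => // sw; apply: F0 => //; apply/negP => /sW /(Iwm_disjoint D m0).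
  by rewrite sw.
have [FB [FBb FBe]] := flow_basis_of_flow q1 D m0 d_tr d_supp d_sum.
exists FB; split=> // t'; apply: le_trans FBe _.
apply: (@le_trans _ _ (C * res t)); first by rewrite /C -/deg !mulrA.
by rewrite ler_pM2l // tmin.
Qed.

(** * The gasket and the pentagonal carpet *)

Section Checker.
Variables (sys : IGS) (letters : seq (S_ sys)) (types : seq (T_ sys)).
Hypotheses (lettersP : forall x, x \in letters) (typesP : forall t, t \in types).

Let forallL (P : pred (S_ sys)) : all P letters -> forall x, P x.
Proof. by move=> /allP h x; exact: h. Qed.

Let forallT (P : pred (T_ sys)) : all P types -> forall t, P t.
Proof. by move=> /allP h t; exact: h. Qed.

Let forallB (P : pred bool) : all P [:: true; false] -> forall b, P b.
Proof. by case/and3P=> ? ? _ []. Qed.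

Definition sym_check (s : S_ sys -> S_ sys) : bool :=
  all (fun a => all (fun b => ((s a == s b) ==> (a == b)) &&
    (adj a b ==> adj (s a) (s b) && all (fun x => all (fun y =>
      glued a b x y ==> glued (s a) (s b) (s x) (s y)) letters) letters))
    letters) letters.

Lemma sym_checkP s : sym_check s -> letter_sym s.
Proof.
move=> /forallL h; have {}h a b := forallL (h a) b.
split=> [a b e|a b ab|a b x y ab xy]; have /andP[/implyP h1 /implyP h2] := h a b.
- exact/eqP/h1/eqP.
- by case/andP: (h2 ab).
- by case/andP: (h2 ab) => _ /forallL /(_ x) /forallL /(_ y) /implyP ->.
Qed.

Definition side_check (t : T_ sys) (b : bool) (x : S_ sys) : bool :=
  has (fun y => if b then Irule t x y else Irule t y x) letters.

Lemma side_checkE t b x : (x \in Iside t b) = side_check t b x.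
Proof.
rewrite /Iside /side_check; case: b; rewrite inE; apply/existsP/hasP => -[y].
all: by move=> h; exists y.
Qed.

Variables (t0 : T_ sys) (rot tau : S_ sys -> S_ sys).
Variables (idx : T_ sys -> bool -> nat) (red : T_ sys -> S_ sys -> S_ sys).

Local Notation "'ALL' x , P" := (all (fun x => P) letters) (at level 200, x name).
Local Notation "'TYP' t , P" := (all (fun t => P) types) (at level 200, t name).
Local Notation "'BOOL' b , P" :=
  (all (fun b => P) [:: true; false]) (at level 200, b name).

Definition rules_check : bool :=
  [&& ALL a, ALL b, E0 a b ==> ~~ E0 b a,
      ALL a, ALL b, ALL c, ALL d, E0 a b && E0 c d && (typ a b == typ c d) ==>
        (a == c) && (b == d),
      TYP t, ALL x, ALL y, ALL z, (Irule t x y && Irule t x z ==> (y == z)) &&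
        (Irule t x y && Irule t z y ==> (x == z)) &
      ALL a, ALL b, ALL x, E0 a b ==>
        ~~ Irule (typ a b) a x && ~~ Irule (typ a b) x b].

Definition group_check : bool :=
  [&& sym_check rot, sym_check tau, sym_check (Defs.eta t0),
      ALL a, adj a (rot a) && has (fun x => has (glued a (rot a) x) letters) letters,
      ALL a, ALL b, has (fun k => b == iter k rot a) (iota 0 5) &
      ALL x, [&& tau (tau x) == x, rot (tau (rot x)) == tau x &
                 Defs.eta t0 (Defs.eta t0 x) == x]].

Definition sides_check : bool :=
  [&& ALL x, side_check t0 false x ==> side_check t0 false (tau x),
      BOOL b, ALL x, side_check t0 b x ==> side_check t0 (~~ b) (Defs.eta t0 x),
      TYP t, ALL x, side_check t true x ==> ~~ side_check t false x &
      TYP t, BOOL b, [&& has (side_check t b) letters, (idx t b < 5)%N &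
        ALL x, (side_check t0 false x ==> side_check t b (iter (idx t b) rot x)) &&
          (Defs.eta t (iter (idx t b) rot x) == iter (idx t (~~ b)) rot (tau x))]] &&
  (TYP t, BOOL b, TYP u, BOOL c,
     (ALL x, side_check t b x == side_check u c x) ==> (idx t b == idx u c)) &&
  (TYP t, sym_check (red t) &&
     (BOOL b, ALL x, side_check t b x ==> side_check t0 b (red t x))).

(** The conditions on letters and types are settled by evaluation; the fold acts on words of every
    length and remains a hypothesis. *)
Lemma dihedral_check :
  rules_check -> group_check -> sides_check ->
  (exists (fold : seq (S_ sys) -> seq (S_ sys)) theta,
    [/\ forall w, size (fold w) = size w,
        forall w v, word_edge w v ->
          word_edge (fold w) (fold v) \/ fold w = fold v,
        injective theta /\ forall w, fold w = w \/ fold w = map theta w,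
        forall w, all (side_check t0 false) w -> fold w = w &
        forall w, all (side_check t0 false) w ->
          fold (map (Defs.eta t0) w) = map rot w]) ->
  dihedral_system t0 rot tau idx.
Proof.
case/and4P=> r1 r2 r3 r4 /and5P[g1 g2 g3 g4 /andP[g5 g6]].
case/andP=> /andP[/and4P[s1 s2 s3 s4] s5] s6 hfold.
split.
- by move=> a b; have /forallL/(_ b)/implyP := forallL r1 a.
- move=> a b c d ab cd /eqP e.
  have /forallL/(_ b)/forallL/(_ c)/forallL/(_ d) := forallL r2 a.
  by rewrite ab cd e => /andP[/eqP -> /eqP ->].
- move=> t x y z xy xz.
  have /forallL/(_ x)/forallL/(_ y)/forallL/(_ z)/andP[+ _] := forallT r3 t.
  by rewrite xy xz => /eqP.
- move=> t x z y xy zy.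
  have /forallL/(_ x)/forallL/(_ y)/forallL/(_ z)/andP[_] := forallT r3 t.
  by rewrite xy zy => /eqP.
- by move=> a b x ab; have /forallL/(_ b)/forallL/(_ x) := forallL r4 a;
    rewrite ab => /andP[].
- by move=> a b x ab; have /forallL/(_ b)/forallL/(_ x) := forallL r4 a;
    rewrite ab => /andP[].
- exact: sym_checkP.
- by move=> a; case/andP: (forallL g4 a).
- move=> a; case/andP: (forallL g4 a) => _ /hasP[x _ /hasP[y _ xy]].
  by exists x, y.
- by move=> a b; have /forallL/(_ b)/hasP[k _ /eqP] := forallL g5 a; exists k.
- exact: sym_checkP.
- by move=> x; case/and3P: (forallL g6 x) => /eqP.
- by move=> x; case/and3P: (forallL g6 x) => _ /eqP.
- by move=> x; rewrite !side_checkE => h; have := forallL s1 x; rewrite h.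
- exact: sym_checkP.
- by move=> x; case/and3P: (forallL g6 x) => _ _ /eqP.
- move=> b x; rewrite !side_checkE => h.
  by have /forallL/(_ x) := forallB s2 b; rewrite h.
- move=> t x; rewrite !side_checkE => h.
  by have /forallL/(_ x) := forallT s3 t; rewrite h.
- move=> t b; have /forallB/(_ b)/and3P[/hasP[x _ xb] _ _] := forallT s4 t.
  by exists x; rewrite side_checkE.
- move=> t b x; rewrite !side_checkE => h.
  by have /forallB/(_ b)/and3P[_ _ /forallL/(_ x)] := forallT s4 t; rewrite h => /andP[].
- move=> t b x.
  by have /forallB/(_ b)/and3P[_ _ /forallL/(_ x)/andP[_ /eqP]] := forallT s4 t.
- move=> t b u c h.
  have /forallB/(_ b)/forallT/(_ u)/forallB/(_ c)/implyP e := forallT s5 t.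
  by apply/eqP/e/allP => x _; rewrite -!side_checkE h.
- by move=> t b; have /forallB/(_ b)/and3P[_ + _] := forallT s4 t.
- move=> t; have /andP[/sym_checkP rs /forallB h] := forallT s6 t.
  exists (red t) => // b x; rewrite !side_checkE => xt.
  by have /forallL/(_ x) := h b; rewrite xt.
- have [fold [theta [f1 f2 f3 f4 f5]]] := hfold; exists fold, theta; split=> // w.
    by rewrite (eq_all (side_checkE _ _)); exact: f4.
  by rewrite (eq_all (side_checkE _ _)); exact: f5.
Qed.

End Checker.

Definition ords n : seq 'I_n.+1 := [seq inZp i | i <- iota 0 n.+1].

Lemma ordsP n (x : 'I_n.+1) : x \in ords n.
Proof.
by apply/mapP; exists (val x); rewrite ?valZpK // mem_iota add0n ltn_ord.
Qed.

Lemma inord_inZp n : @inord n = fun k => if (k < n.+1)%N then inZp k else ord0.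
Proof.
apply/funext => k; apply: val_inj; case: ifP => kn; rewrite /= /inord val_insubd kn //.
by rewrite modn_small.
Qed.

Lemma m5_inZp : m5 = inZp.
Proof. by apply/funext => k; apply: val_inj; rewrite /= inordK ?ltn_pmod. Qed.

(* Copies of the two systems that evaluate: [inord] is blocked by an opaque
   decision procedure, [inZp] is not. *)
Definition gasket_computable : IGS :=
  let ord3 k : 'I_3 := if (k < 3)%N then inZp k else ord0 in
  let swap i j (x : 'I_3) :=
    if val x == i then ord3 j else if val x == j then ord3 i else x in
  {| S_ := 'I_3; T_ := 'I_3; E0 := sg_E;
     typ := fun x y => if (val x == 0%N) && (val y == 1%N) then ord3 0%N
       else if (val x == 1%N) && (val y == 2%N) then ord3 1%N else ord3 2%N;
     Irule := sg_I;
     Defs.eta := fun t => match val t with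
       | 0%N => swap 0%N 1%N | 1%N => swap 1%N 2%N | _ => swap 0%N 2%N end |}.

Definition pentagon_eta (k x : 'I_5) : 'I_5 :=
  if x == k then k
  else if x == inZp (val k + 1) then inZp (val k + 4)
  else if x == inZp (val k + 4) then inZp (val k + 1)
  else if x == inZp (val k + 2) then inZp (val k + 3)
  else inZp (val k + 2).

Definition pentagon_computable : IGS :=
  {| S_ := 'I_5; T_ := 'I_5;
     E0 := fun x y : 'I_5 => y == inZp (val x + 1); typ := pc_typ;
     Irule := fun t x y : 'I_5 => ((x == inZp (val t + 1)) && (y == t)) ||
       ((x == inZp (val t + 2)) && (y == inZp (val t + 4)));
     Defs.eta := fun t : 'I_5 => pentagon_eta (inZp (val t + 3)) |}.

Lemma gasketE : gasket = gasket_computable.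
Proof. by rewrite /gasket /sg_typ /sg_eta /swap3 inord_inZp. Qed.

Lemma pentagonE : pentagon = pentagon_computable.
Proof. by rewrite /pentagon /pc_E /pc_I /pc_eta /eta5 m5_inZp. Qed.

(** Each side is a single corner, and [idx] lists these corners; [tau] is negation modulo 3 and
    fixes the corner 0 of [I_{a,-}]. *)
Lemma gasket_dihedral : dihedral_system (sys := gasket_computable) (ord0 : 'I_3)
  (fun x : 'I_3 => inZp (x + 1) : 'I_3) (fun x : 'I_3 => inZp (2 * x) : 'I_3)
  (fun (t : 'I_3) b => nth 0%N (if b then [:: 1; 2; 2] else [:: 0; 1; 0])%N t).
Proof.
(* The maps [x], [x + 2] and [2 * x] modulo 3 carry the sides of types [a], [b], [c] to those of
   type [a]. *)
apply (@dihedral_check gasket_computable (ords 2) (ords 2) (@ordsP 2) (@ordsP 2)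
  _ _ _ _ (fun (t x : 'I_3) => inZp (nth 0 [:: val x; x + 2; 2 * x] t)%N : 'I_3)).
- by vm_compute.
- by vm_compute.
- by vm_compute.
(* The flip of type [a] already agrees with the rotation on the corner 0. *)
exists id, id; split=> //; first by move=> w v; left.
  by split=> // w; left.
move=> w /allP w0; apply/eq_in_map => x /w0.
have /allP h : all (fun x => side_check (sys := gasket_computable) (ords 2)
  (ord0 : 'I_3) false x ==> (Defs.eta (i := gasket_computable) (ord0 : 'I_3) x
    == (inZp (x + 1) : 'I_3))) (ords 2) by vm_compute.
by move=> hx; have := h x (ordsP x); rewrite hx => /eqP.
Qed.

(** * Folding the pentagonal carpet *)

Local Notation P5 := pentagon_computable.
Local Notation theta := (pentagon_eta (inZp 1)).

Lemma ord5_check (P : 'I_5 -> bool) : all P (ords 4) -> forall x, P x.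
Proof. by move=> /allP h x; exact/h/ordsP. Qed.

(** The near letters are those of [I_{a,-}]; the reflection [theta] exchanges them with the far
    letters. *)
Definition near (a : 'I_5) : bool := (val a == 0%N) || (val a == 4).
Definition far (a : 'I_5) : bool := (val a == 2) || (val a == 3).

(* [theta] fixes the letter 1, so a word lies on the side of the mirror given by
   its first letter other than 1. *)
Fixpoint pentagon_fold (w : seq 'I_5) : seq 'I_5 :=
  if w is a :: w' then
    if near a then w else if far a then map theta w else a :: pentagon_fold w'
  else [::].

Lemma fold_not_far w : all (predC far) w -> pentagon_fold w = w.
Proof.
elim: w => //= a w IHw /andP[/negbTE ->] /IHw ->; by case: ifP.
Qed.

Lemma theta_fix a : near a = false -> far a = false -> theta a = a.
Proof.
have /ord5_check/(_ a) : all (fun a => near a || far a || (theta a == a)) (ords 4).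
  by vm_compute.
by move=> h na fa; move: h; rewrite na fa => /eqP.
Qed.

Lemma fold_not_near w : all (predC near) w -> pentagon_fold w = map theta w.
Proof.
elim: w => //= a w IHw /andP[/negbTE na] /IHw ->; rewrite na.
by case: ifP => // /(theta_fix na) ->.
Qed.

Lemma fold_keep a w : ~~ far a -> near a || all (predC far) w ->
  pentagon_fold (a :: w) = a :: w.
Proof.
move=> fa /orP[na|fw]; first by rewrite /= na.
by rewrite fold_not_far //= fa.
Qed.

Lemma fold_flip a w : ~~ near a -> far a || all (predC near) w ->
  pentagon_fold (a :: w) = map theta (a :: w).
Proof.
move=> na /orP[fa|nw]; first by rewrite /= (negbTE na) fa.
by rewrite fold_not_near //= na.
Qed.

(** The positions of an edge at the first disagreement: in the near half, in the far half, or across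
    the mirror. In a half, the letters glued after the mirror letter 1 do not enter the opposite
    half; across the mirror, [theta] matches the glued letters. *)
Definition mirror_check (a b x y : 'I_5) : bool :=
  adj (sys := P5) a b && glued (sys := P5) a b x y ==>
  [&& ~~ far a && ~~ far b ==> (near a || ~~ far x) && (near b || ~~ far y),
      ~~ near a && ~~ near b ==> (far a || ~~ near x) && (far b || ~~ near y),
      near a && far b ==> (theta y == x) & far a && near b ==> (theta x == y)].

Lemma mirror_checkP a b x y : mirror_check a b x y.
Proof.
have h : all (fun a => all (fun b => all (fun x => all (mirror_check a b x)
  (ords 4)) (ords 4)) (ords 4)) (ords 4) by vm_compute.
by move: h => /ord5_check/(_ a)/ord5_check/(_ b)/ord5_check/(_ x)/ord5_check.
Qed.

Definition letter_check (a b : 'I_5) : bool :=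
  (near a ==> ~~ far a) &&
  (adj (sys := P5) a b && near a && far b ==> (theta b == a) && (theta a == b)).

Lemma letter_checkP a b : letter_check a b.
Proof.
have h : all (fun a => all (letter_check a) (ords 4)) (ords 4) by vm_compute.
by move: h => /ord5_check/(_ a)/ord5_check.
Qed.

Lemma near_far a : near a -> ~~ far a.
Proof. by case/andP: (letter_checkP a a) => /implyP. Qed.

Lemma theta_sym : letter_sym (sys := P5) theta.
Proof. by apply: (@sym_checkP P5 (ords 4) (@ordsP 4)); vm_compute. Qed.

Lemma all2_all_l (T : Type) (r : T -> T -> bool) (p : pred T) w v :
  (forall x y, r x y -> p x) -> all2 r w v -> all p w.
Proof.
by move=> rp; elim: w v => [|x w IHw] [|y v] //= /andP[/rp -> /IHw].
Qed.

Lemma all2_all_r (T : Type) (r : T -> T -> bool) (p : pred T) w v :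
  (forall x y, r x y -> p y) -> all2 r w v -> all p v.
Proof.
by move=> rp; elim: w v => [|x w IHw] [|y v] //= /andP[/rp -> /IHw].
Qed.

Lemma all2_map (T : Type) (r : T -> T -> bool) (h : T -> T) w v :
  (forall x y, r x y -> h x = y) -> all2 r w v -> map h w = v.
Proof.
by move=> rp; elim: w v => [|x w IHw] [|y v] //= /andP[/rp -> /IHw ->].
Qed.

Lemma all2_map_r (T : Type) (r : T -> T -> bool) (h : T -> T) w v :
  (forall x y, r x y -> h y = x) -> all2 r w v -> map h v = w.
Proof.
by move=> rp; elim: w v => [|x w IHw] [|y v] //= /andP[/rp -> /IHw ->].
Qed.

(** At the first disagreement, an edge within a half is kept or reflected as a whole, while [theta]
    exchanges the ends of an edge across the mirror, so both fold to the same word. *)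
Lemma pentagon_fold_edge (w v : seq 'I_5) : word_edge (sys := P5) w v ->
  word_edge (sys := P5) (pentagon_fold w) (pentagon_fold v) \/
  pentagon_fold w = pentagon_fold v.
Proof.
elim: w v => [|a w IHw] [|b v] // e.
have [ab|nab] := eqVneq a b.
  move: e; rewrite ab [word_edge _ _]/= eqxx => e; rewrite /=.
  (* A common first letter decides the half for both words, unless it is 1 and the induction
     continues. *)
  case: ifP => _; first by left; rewrite /= eqxx.
  case: ifP => _; last first.
    by case: (IHw _ e) => [{}e|->]; [left; rewrite /= eqxx | right].
  have {}e : word_edge (sys := P5) (b :: w) (b :: v) by rewrite /= eqxx.
  left; exact (word_edge_map theta_sym e).
have /andP[ab gl] : adj (sys := P5) a b && all2 (glued (sys := P5) a b) w v.
  by move: e; rewrite /= (negbTE nab).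
have mc x y : glued (sys := P5) a b x y -> _ :=
  fun xy => implyP (mirror_checkP a b x y) (introT andP (conj ab xy)).
have [/andP[na nb]|nf] := boolP (~~ far a && ~~ far b).
  left; have h x y : glued (sys := P5) a b x y ->
      (near a || ~~ far x) && (near b || ~~ far y).
    by case/mc/and4P; rewrite na nb.
  rewrite !fold_keep //; apply/orP.
    case: (boolP (near b)) => bb; [by left|right]; apply: all2_all_r gl => x y.
    by case/h/andP; rewrite (negbTE bb).
  case: (boolP (near a)) => aa; [by left|right]; apply: all2_all_l gl => x y.
  by case/h/andP; rewrite (negbTE aa).
have [/andP[na nb]|nn] := boolP (~~ near a && ~~ near b).
  left; have h x y : glued (sys := P5) a b x y ->
      (far a || ~~ near x) && (far b || ~~ near y).
    by case/mc/and4P => _; rewrite na nb.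
  rewrite !fold_flip //; first exact: word_edge_map theta_sym e.
    apply/orP; case: (boolP (far b)) => bb; [by left|right].
    by apply: all2_all_r gl => x y; case/h/andP; rewrite (negbTE bb).
  apply/orP; case: (boolP (far a)) => aa; [by left|right].
  by apply: all2_all_l gl => x y; case/h/andP; rewrite (negbTE aa).
right; have [na|na] := boolP (near a).
  have fb : far b by move: nf; rewrite (near_far na) /= negbK.
  have nb : ~~ near b by apply/negP => /near_far; rewrite fb.
  have /andP[_] := letter_checkP a b; rewrite ab na fb => /andP[/eqP ba _].
  rewrite fold_keep ?near_far ?na // fold_flip ?fb //= ba; congr (_ :: _).
  apply/esym; apply: all2_map_r gl => x y.
  by case/mc/and4P=> _ _; rewrite na fb => /eqP.
have nb : near b by move: nn; rewrite na /= negbK.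
have fa : far a by move: nf; rewrite (near_far nb) andbT negbK.
have ba : adj (sys := P5) b a by rewrite /adj orbC.
have /andP[_] := letter_checkP b a; rewrite ba nb fa => /andP[/eqP e1 _].
rewrite [RHS]fold_keep ?near_far ?nb // fold_flip ?fa //= e1; congr (_ :: _).
apply: all2_map gl => x y.
by case/mc/and4P=> _ _ _; rewrite nb fa => /eqP.
Qed.

(** Modulo 5, [tau x = -1 - x], and the sides [I_{t,-} = {t, t - 1}] and [I_{t,+} = {t + 1, t + 2}]
    are the rotations of [{0, 4}] by [t] and [t + 2]. *)
Lemma pentagon_dihedral : dihedral_system (sys := P5) (ord0 : 'I_5)
  (fun x : 'I_5 => inZp (x + 1) : 'I_5) (fun x : 'I_5 => inZp (4 + 4 * x) : 'I_5)
  (fun (t : 'I_5) b => if b then (t + 2) %% 5 else t)%N.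
Proof.
(* Adding [4 * t] is rotation by [-t], which carries type [t] to type [a]. *)
apply (@dihedral_check P5 (ords 4) (ords 4) (@ordsP 4) (@ordsP 4)
  _ _ _ _ (fun t x : 'I_5 => inZp (x + 4 * t) : 'I_5)).
- by vm_compute.
- by vm_compute.
- by vm_compute.
have /ord5_check side_near : all (fun x =>
    side_check (sys := P5) (ords 4) (ord0 : 'I_5) false x ==>
    [&& near x, ~~ near (Defs.eta (i := P5) (ord0 : 'I_5) x) &
      theta (Defs.eta (i := P5) (ord0 : 'I_5) x) == inZp (x + 1)]) (ords 4).
  by vm_compute.
exists pentagon_fold, theta; split.
- by elim=> //= a w IHw; case: ifP => // _; case: ifP; rewrite /= ?size_map ?IHw.
- exact: pentagon_fold_edge.
- split; first by case: theta_sym.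
  elim=> [|a w [e|e]]; first by left.
  + rewrite /= e; case: ifP => _; first by left.
    by case: ifP => _; [right | left].
  + rewrite /= e; case: ifP => na; first by left.
    by case: ifP => fa; right=> //; rewrite (theta_fix na fa).
- move=> w /allP w0; apply: fold_not_far; apply/allP => x /w0 xs /=.
  by apply: near_far; have := side_near x; rewrite xs => /andP[].
(* The flip takes [{0, 4}] to [{1, 2}], which has no near letter, so the fold applies [theta] to the
   whole word. *)
- move=> w /allP w0; rewrite fold_not_near.
    rewrite -map_comp; apply/eq_in_map => x /w0 xs /=.
    by have := side_near x; rewrite xs => /and3P[_ _ /eqP].
  apply/allP => _ /mapP[x /w0 xs ->].
  by have := side_near x; rewrite xs => /and3P[].
Qed.

Theorem theorem6p13 (R : realType) (sys : IGS)
    (Hsys : sys = gasket \/ sys = pentagon)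
    (p : R) (Hp : 1 < p) (q : R) (Hq : q = p / (p - 1)) :
  exists C : R, 0 < C /\
    forall m : nat, (0 < m)%N ->
      exists FB : {set m.-tuple (S_ sys)} -> {set m.-tuple (S_ sys)} ->
                  tV sys m -> tV sys m -> R,
        is_flow_basis FB /\
        forall t : T_ sys,
          FB_energy q FB <= C * Eq_res (@Em sys m) q (Iwm m t false) (Iwm m t true).
Proof.
have q1 : 1 <= q.
  by rewrite Hq ler_pdivlMr ?subr_gt0 // mul1r gerBl.
case: Hsys => ->.
  by rewrite gasketE; exact: dihedral_flow_bases gasket_dihedral.
by rewrite pentagonE; exact: dihedral_flow_bases pentagon_dihedral.
Qed.
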